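(* Let $0<\delta<1$, let $\Omega=\{(r,\phi):\delta\le r\le1,\ \phi\in[0,2\pi]\}$ be the planar annulus, and let $\mathbf u_0=(-a(r)\sin\phi,a(r)\cos\phi)\in L^2(\Omega)$ be a circularly symmetric initial velocity. For $\nu_1,\nu_2>0$ let $\mathbf u_v^\nu(t)=e^{tA_\nu}\mathbf u_0$ be the corresponding solution of the anisotropic Navier–Stokes (reduced) problem described in the context, and let $\mathbf u_v^0\equiv\mathbf u_0$ be the corresponding (steady) Euler solution. Then, for any fixed $0<T<\infty$, $$\|\mathbf u_v^\nu-\mathbf u_v^0\|_{L^\infty(0,T;L^2(\Omega))}=\|e^{tA_\nu}\mathbf u_0-\mathbf u_0\|_{L^\infty(0,T;L^2(\Omega))}\to0\qquad\text{as }\nu_1,\nu_2\to0.$$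
   Context: Planar circularly symmetric flow $\mathbf u=u_\phi(t,r)\mathbf e_\phi$ with anisotropic viscosity and zero forcing; $\nu=(\nu_1,\nu_2)$ are the radial and angular viscosities, and no condition on their relative size is imposed. In Cartesian coordinates $(x,y)$, with $r=(x^2+y^2)^{1/2}$ and $\tan\phi=y/x$, the velocity is $\mathbf u_v^\nu=(-u_\phi^\nu\sin\phi,u_\phi^\nu\cos\phi)$ and solves $$\partial_t\mathbf u_v^\nu=A_\nu\mathbf u_v^\nu\ \text{ in }\Omega\times[0,T],\qquad \mathbf u_v^\nu|_{t=0}=\mathbf u_0,\qquad \mathbf u_v^\nu=0\ \text{ on }\partial\Omega\times[0,T],$$ where $A_\nu=\nabla\cdot(J\nabla\,\cdot\,)$ acts componentwise and $$J=\begin{pmatrix}\nu_1\cos^2\phi+\nu_2\sin^2\phi&(\nu_1-\nu_2)\sin\phi\cos\phi\\(\nu_1-\nu_2)\sin\phi\cos\phi&\nu_1\sin^2\phi+\nu_2\cos^2\phi\end{pmatrix}.$$ $A_\nu$ is regarded as an unbounded self-adjoint operator on $L^2(\Omega)$ with domain $H^2(\Omega)\cap H_0^1(\Omega)$, and $e^{tA_\nu}$, $t\ge0$, is the $C_0$ semigroup of contractions it generates. *)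

(* Defs.v *)
From HB Require Import structures.
From mathcomp Require Import all_boot all_order all_algebra.
From mathcomp Require Import all_classical all_reals all_analysis measurable_realfun.

Set Implicit Arguments.
Unset Strict Implicit.
Unset Printing Implicit Defensive.

Import Order.TTheory GRing.Theory Num.Theory.
Import numFieldNormedType.Exports.

Local Open Scope classical_set_scope.
Local Open Scope ring_scope.

Section annulus.
Context {R : realType}.
Implicit Types (delta : R) (z : R * R).

Definition radius z : R := Num.sqrt (z.1 ^+ 2 + z.2 ^+ 2).

(* cosine and sine of the polar angle [phi] of [z], for [z] nonzero *)
Definition cos_angle z : R := z.1 / radius z.
Definition sin_angle z : R := z.2 / radius z.

Definition annulus delta : set (measurableTypeR R * measurableTypeR R) :=
  [set z | delta <= radius z <= 1].

Definition annulus_interior delta : set (R * R) :=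
  [set z | delta < radius z < 1].

Lemma measurable_annulus delta : measurable (annulus delta).
Proof.
have mr : measurable_fun setT
    (radius : measurableTypeR R * measurableTypeR R -> measurableTypeR R).
  apply: measurableT_comp.
    exact: continuous_measurable_fun (@sqrt_continuous R).
  by apply: measurable_funD; apply: measurable_funX.
have -> : annulus delta = setT `&` radius @^-1` `[delta, 1].
  by rewrite setTI; apply/seteqP; split => z /=; rewrite in_itv.
by apply: mr => //; exact: measurable_itv.
Qed.

Definition annulus_measure delta :
    {measure set (measurableTypeR R * measurableTypeR R) -> \bar R} :=
  mrestr (lebesgue_measure \x lebesgue_measure)%E (measurable_annulus delta).

(* The elements of [L2 delta] are square-integrable functions, not classes of
   them: equality in the Lebesgue space L^2 is equality almost everywhere. *)
Definition L2 delta := LfunType (annulus_measure delta) (lee1n 2).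

Definition L2norm delta (f : R * R -> R) : \bar R :=
  'N[annulus_measure delta]_2%:E [EFin \o f].

Definition L2eq delta (f g : R * R -> R) : Prop :=
  \forall z \ae annulus_measure delta, f z = g z.

End annulus.

Section sobolev.
Context {R : realType} (delta : R).
Implicit Types (f g u : R * R -> R) (v : R * R).

Definition e_x : R * R := (1, 0).
Definition e_y : R * R := (0, 1).

Definition iter_derive (vs : seq (R * R)) f : R * R -> R :=
  foldr (fun v g z => 'D_v g z) f vs.

(* C^oo: the iterated derivatives in all directions exist and are continuous *)
Definition smooth f : Prop := forall vs : seq (R * R),
  continuous (iter_derive vs f) /\
  forall z v, derivable (iter_derive vs f) z v.

Definition test_function f : Prop :=
  [/\ smooth f, compact (closure [set z | f z != 0]) &
      closure [set z | f z != 0] `<=` annulus_interior delta].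

Definition weak_derivative v u g : Prop :=
  forall phi, test_function phi ->
    \int[annulus_measure delta]_z (u z * 'D_v phi z) =
    - \int[annulus_measure delta]_z (g z * phi z).

Definition weak_gradient u (gx gy : L2 delta) : Prop :=
  weak_derivative e_x u gx /\ weak_derivative e_y u gy.

Definition sobolev_H1 (u : L2 delta) : Prop :=
  exists gx gy, weak_gradient u gx gy.

Definition sobolev_H2 (u : L2 delta) : Prop :=
  exists gx gy, [/\ weak_gradient u gx gy, sobolev_H1 gx & sobolev_H1 gy].

(* closure of C_c^oo in the H^1 norm *)
Definition sobolev_H10 (u : L2 delta) : Prop :=
  exists gx gy : L2 delta, weak_gradient u gx gy /\
    forall e : R, 0 < e -> exists phi,
      [/\ test_function phi,
          (L2norm delta (fun z => (u z - phi z)%R) < e%:E)%E,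
          (L2norm delta (fun z => (gx z - 'D_e_x phi z)%R) < e%:E)%E &
          (L2norm delta (fun z => (gy z - 'D_e_y phi z)%R) < e%:E)%E].

End sobolev.

Section viscous_operator.
Context {R : realType} (delta : R) (nu : R * R).
Implicit Type z : R * R.

Definition J_xx z :=
  nu.1 * cos_angle z ^+ 2 + nu.2 * sin_angle z ^+ 2.
Definition J_xy z :=
  (nu.1 - nu.2) * sin_angle z * cos_angle z.
Definition J_yy z :=
  nu.1 * sin_angle z ^+ 2 + nu.2 * cos_angle z ^+ 2.

Definition div_J_grad (u f : L2 delta) : Prop :=
  exists gx gy hx hy : L2 delta,
    [/\ weak_gradient u gx gy,
        weak_derivative delta e_x (fun z => J_xx z * gx z + J_xy z * gy z) hx,
        weak_derivative delta e_y (fun z => J_xy z * gx z + J_yy z * gy z) hy &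
        L2eq delta f (fun z => hx z + hy z)].

(* Graph of the unbounded operator div (J grad .) with domain the intersection
   of H^2 and H^1_0, acting on scalar functions. *)
Definition A_graph (u f : L2 delta) : Prop :=
  [/\ sobolev_H2 u, sobolev_H10 u & div_J_grad u f].

End viscous_operator.

Section semigroup.
Context {R : realType} (delta : R).
Implicit Types (S : R -> L2 delta -> L2 delta) (f g : L2 delta).

Definition C0_contraction_semigroup S : Prop :=
  [/\ forall t a f g, 0 <= t ->
        L2eq delta (S t (a *: f + g)) (a *: S t f + S t g),
      forall f, L2eq delta (S 0 f) f,
      forall s t f, 0 <= s -> 0 <= t -> L2eq delta (S (s + t) f) (S s (S t f)),
      forall t f, 0 <= t -> (L2norm delta (S t f) <= L2norm delta f)%E &
      forall f, L2norm delta (S t f - f) @[t --> 0^'+] --> 0%E].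

Definition generator_graph S f g : Prop :=
  L2norm delta (t^-1 *: (S t f - f) - g) @[t --> 0^'+] --> 0%E.

(* [S t] is exp(t A) for the unbounded operator A with graph [A] *)
Definition generated_by (A : L2 delta -> L2 delta -> Prop) S : Prop :=
  C0_contraction_semigroup S /\ forall f g, generator_graph S f g <-> A f g.

End semigroup.

Section flow.
Context {R : realType} (delta : R).
Implicit Types (u : L2 delta * L2 delta) (w : R -> L2 delta * L2 delta).

Definition circularly_symmetric (a : R -> R) u : Prop :=
  L2eq delta u.1 (fun z => - a (radius z) * sin_angle z) /\
  L2eq delta u.2 (fun z => a (radius z) * cos_angle z).

(* the scalar operator [S t] applied to each component of the velocity [u] *)
Definition navier_stokes_flow (S : R -> L2 delta -> L2 delta) u :
    R -> L2 delta * L2 delta :=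
  fun t => (S t u.1, S t u.2).

Definition euler_flow u : R -> L2 delta * L2 delta := fun=> u.

Definition L2vec_norm u : \bar R :=
  L2norm delta (fun z => Num.sqrt (u.1 z ^+ 2 + u.2 z ^+ 2)).

Definition LinfL2_norm (T : R) w : \bar R :=
  'N[mrestr lebesgue_measure (measurable_itv `]0, T[)]_+oo
    [(fun t => L2vec_norm (w t))].

End flow.

(* Main.v *)
Require Import Defs.
From HB Require Import structures.
From mathcomp Require Import all_boot all_order all_algebra.
From mathcomp Require Import all_classical all_reals all_analysis.
From mathcomp Require Import ring lra measurable_realfun ess_sup_inf.

Set Implicit Arguments.
Unset Strict Implicit.
Unset Printing Implicit Defensive.

Import Order.TTheory GRing.Theory Num.Theory.
Import numFieldNormedType.Exports.

Local Open Scope classical_set_scope.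
Local Open Scope ring_scope.

(** The proof compares the semigroup [S] generated by [A_nu] with the identity on a
    dense set of initial data that lie in the domain of [A_nu] for every [nu].

    If [f] is in the domain of the generator [A] of a contraction semigroup, then
    [||S t f - f|| <= t ||A f||] ([generator_displacement]). For an arbitrary [u] in
    [L^2] it follows that [||S t u - u|| <= 2 ||u - f|| + t ||A f||]
    ([displacement_le]).

    A test function [f] vanishes near the boundary, hence meets the boundary
    condition and belongs to the domain of [A_nu] whatever [nu] is. As [J] depends
    linearly on the viscosities, [A_nu f = nu.1 g1 + nu.2 g2] with [g1] and [g2] in
    [L^2] independent of [nu] ([A_graph_test]), and [||A_nu f||] tends to zero with
    [nu]. Weak derivatives of smooth functions are their derivatives by Fubini's
    theorem ([weak_derivative_partial]). The singularity at the origin of the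
    coefficients of [J] is outside the annulus, and it is removed by altering the
    squared radius near the origin ([sqradius_reg]).

    Test functions are dense in [L^2] of the annulus ([L2_approximable]): products of
    functions such as [exp (-1/x)] approximate the indicators of quadrants, whence
    the indicators of measurable sets by Dynkin's lemma, and all of [L^2] by simple
    functions and dominated convergence.

    Given [u] and [e], choose first [f] with [2 ||u - f||] at most [e / 2], then [nu]
    small enough for [T ||A_nu f||] to be at most [e / 2]: the displacement of [u] is at
    most [e] on the whole interval [0 < t < T] ([displacement_vanishes]). The theorem
    is this statement for the two Cartesian components of the velocity. *)

(** * Regularity of functions on the plane *)

Section smooth_calculus.
Context {R : realType}.
Implicit Types (f g p : R * R -> R) (z v : R * R).

Definition partial v f : R * R -> R := fun z => 'D_v f z.

(** Regularity graded by the number of derivatives still to be taken: the product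
    and chain rules lose one derivative at each step, so that they can be proved
    by induction on [k], and smoothness is regularity of every order. *)
Fixpoint Ck k f : Prop :=
  continuous f /\
  if k is k'.+1 then forall v, (forall z, derivable f z v) /\ Ck k' (partial v f)
  else True.

Lemma Ck_continuous k f : Ck k f -> continuous f.
Proof. by case: k => [|k] []. Qed.

Lemma Ck_derivable k f z v : Ck k.+1 f -> derivable f z v.
Proof. by move=> [_ /(_ v)[]]. Qed.

Lemma Ck_partial k f v : Ck k.+1 f -> Ck k (partial v f).
Proof. by move=> [_ /(_ v)[]]. Qed.

Lemma CkW k f : Ck k.+1 f -> Ck k f.
Proof.
elim: k f => [|k IH] f [cf Hf]; split=> // v.
by have [df /IH] := Hf v.
Qed.

Lemma iter_derive_rcons vs v f :
  iter_derive (rcons vs v) f = iter_derive vs (partial v f).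
Proof. by rewrite /iter_derive foldr_rcons. Qed.

Lemma smoothP f : smooth f <-> forall k, Ck k f.
Proof.
split=> [sf k|Cf vs].
  elim: k f sf => [|k IH] f sf; split=> //.
  - by have [] := sf [::].
  - by have [] := sf [::].
  - move=> v; split=> [z|]; first by have [_] := sf [::]; exact.
    by apply: IH => vs; rewrite -iter_derive_rcons; exact: sf.
elim/last_ind: vs f Cf => [|vs v IH] f Cf.
  by split=> [|z v]; [exact: (Cf 0%N).1|exact: Ck_derivable (Cf 1%N)].
by rewrite iter_derive_rcons; apply: IH => k; exact: Ck_partial.
Qed.

Lemma Ck_eq k f g : f =1 g -> Ck k f -> Ck k g.
Proof. by move=> /funext ->. Qed.

Lemma Ck_cst k c : Ck k (cst c).
Proof.
elim: k c => [|k IH] c; split=> //; try exact: cst_continuous.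
move=> v; split=> [z|]; first exact: derivable_cst.
by apply: Ck_eq (IH 0) => z; rewrite /partial derive_cst.
Qed.

Lemma Ck_add k f g : Ck k f -> Ck k g -> Ck k (f \+ g).
Proof.
elim: k f g => [|k IH] f g Cf Cg; (split=> [z|//]; first by
  apply: cvgD; [exact: Ck_continuous Cf z|exact: Ck_continuous Cg z]).
move=> v; split=> [z|].
  by apply: derivableD; [exact: Ck_derivable Cf|exact: Ck_derivable Cg].
apply: Ck_eq (IH _ _ (Ck_partial v Cf) (Ck_partial v Cg)) => z.
rewrite /partial /= deriveD //; [exact: Ck_derivable Cf|exact: Ck_derivable Cg].
Qed.

Lemma Ck_mul k f g : Ck k f -> Ck k g -> Ck k (f \* g).
Proof.
elim: k f g => [|k IH] f g Cf Cg; (split=> [z|//]; first by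
  apply: cvgM; [exact: Ck_continuous Cf z|exact: Ck_continuous Cg z]).
move=> v; split=> [z|].
  by apply: derivableM; [exact: Ck_derivable Cf|exact: Ck_derivable Cg].
have := Ck_add (IH _ _ (CkW Cf) (Ck_partial v Cg))
               (IH _ _ (CkW Cg) (Ck_partial v Cf)).
apply: Ck_eq => z; rewrite /partial /= deriveM //;
  [exact: Ck_derivable Cf|exact: Ck_derivable Cg].
Qed.

Lemma Ck_scale k c f : Ck k f -> Ck k (c \*: f).
Proof. by move=> /(Ck_mul (Ck_cst k c)); exact: Ck_eq. Qed.

Lemma is_derive_fst z v : is_derive z v (fst : R * R -> R) v.1.
Proof.
have df : differentiable (fst : R * R -> R) z.
  by apply: linear_differentiable => x; exact: cvg_fst.
apply: DeriveDef; first exact: diff_derivable.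
by rewrite deriveE // diff_lin // => x; exact: cvg_fst.
Qed.

Lemma is_derive_snd z v : is_derive z v (snd : R * R -> R) v.2.
Proof.
have df : differentiable (snd : R * R -> R) z.
  by apply: linear_differentiable => x; exact: cvg_snd.
apply: DeriveDef; first exact: diff_derivable.
by rewrite deriveE // diff_lin // => x; exact: cvg_snd.
Qed.

Lemma Ck_fst k : Ck k fst.
Proof.
case: k => [|k]; split=> //; try by move=> z; exact: cvg_fst.
move=> v; split=> [z|]; first by have [] := is_derive_fst z v.
by apply: Ck_eq (Ck_cst k v.1) => z; have [_] := is_derive_fst z v.
Qed.

Lemma Ck_snd k : Ck k snd.
Proof.
case: k => [|k]; split=> //; try by move=> z; exact: cvg_snd.
move=> v; split=> [z|]; first by have [] := is_derive_snd z v.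
by apply: Ck_eq (Ck_cst k v.2) => z; have [_] := is_derive_snd z v.
Qed.

End smooth_calculus.

(** * Flat functions of one variable *)

Section chain_rule.
Context {R : realType}.
Implicit Types (f p : R * R -> R) (h : R -> R) (z v : R * R).

Lemma derive_line f z v : 'D_v f z = 'D_1 (fun t : R => f (t *: v + z)) 0.
Proof.
rewrite /derive; set g1 := fun s : R => s^-1 *: _; set g2 := fun s : R => s^-1 *: _.
suff -> : g1 = g2 by [].
by apply/funext => t; rewrite /g1 /g2 /= addr0 scale0r add0r [_%:A]mulr1.
Qed.

(** Directional derivatives are derivatives along a line, which reduces the chain
    rule below to functions of one real variable. *)
Lemma is_derive_line f z v a :
  is_derive z v f a <-> is_derive (0 : R) 1 (fun t : R => f (t *: v + z)) a.
Proof.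
split=> -[df <-]; apply: DeriveDef.
- exact: (derivable1P f z v).1.
- by rewrite -derive_line.
- exact: (derivable1P f z v).2.
- by rewrite -derive_line.
Qed.

Lemma is_derive_chain h p z v a b :
  is_derive (p z) 1 h a -> is_derive z v p b -> is_derive z v (h \o p) (a * b).
Proof.
move=> dh /is_derive_line dp; apply/is_derive_line.
apply: (@is_derive1_comp _ h (fun t : R => p (t *: v + z))) => //.
by rewrite scale0r add0r.
Qed.

End chain_rule.

Section flat_function.
Context {R : realType}.
Implicit Types (P : {poly R}) (x y : R).

(** The functions [P (1/x) exp (-1/x)], extended by zero to the left of [0]. The
    factor [P] is there because derivatives of [exp (-1/x)] have this form: the
    family is closed under differentiation, and all its members are smooth. *)
Definition flat P x : R := if 0 < x then P.[x^-1] * expR (- x^-1) else 0.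

Lemma exprn_le_expR n y : 0 <= y -> y ^+ n <= n`!%:R * expR y.
Proof.
move=> y0; case: n => [|n].
  by rewrite expr0 mul1r; apply: le_trans (expR_ge1Dx _); rewrite lerDl.
rewrite -ler_pdivrMl ?ltr0n ?fact_gt0// mulrC.
apply: le_trans (expR_ge1Dxn n y0).
by rewrite lerDr.
Qed.

(** A monomial [y ^ i] times [y ^ 2 exp (- y)], where [y = 1/x], is at most [(i + 2)!];
    the quadratic bound makes the derivative at the origin vanish. *)
Lemma flat_le P : exists C, forall x, `|flat P x| <= C * x ^+ 2.
Proof.
pose c i : R := `|P`_i| * (i + 2)`!%:R.
exists (\sum_(i < size P) c i) => x.
rewrite /flat; case: ifPn => [x0|_]; last first.
  rewrite normr0 mulr_ge0 ?sqr_ge0// sumr_ge0// => i _.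
  by rewrite mulr_ge0.
rewrite -ler_pdivrMr ?exprn_gt0// normrM (gtr0_norm (expR_gt0 _)).
rewrite horner_coef -mulrA.
apply: (@le_trans _ _ ((\sum_(i < size P) `|P`_i * x^-1 ^+ i|) *
                       (expR (- x^-1) / x ^+ 2))).
  rewrite ler_wpM2r ?divr_ge0 ?expR_ge0 ?sqr_ge0//.
  exact: ler_norm_sum.
rewrite mulr_suml ler_sum// => i _.
have y0 : 0 <= x^-1 by rewrite invr_ge0 ltW.
rewrite normrM -mulrA ler_wpM2l// ger0_norm ?exprn_ge0// expRN.
rewrite mulrCA -exprVn -exprD mulrC ler_pdivrMr ?expR_gt0//.
exact: exprn_le_expR.
Qed.

Lemma is_derive_flat P x :
  is_derive x 1 (flat P) (flat ('X^2 * (P - P^`())) x).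
Proof.
have [x0|x0|->] := ltgtP x 0.
- rewrite {2}/flat ltNge (ltW x0) /=.
  apply: (@near_eq_is_derive _ _ _ (cst 0)).
  near=> y; rewrite /flat ifF//; apply/negbTE; rewrite -leNgt ltW//.
  by near: y; exact: lt_nbhsl.
- apply: (@near_eq_is_derive _ _ _ (fun y => P.[y^-1] * expR (- y^-1))).
    near=> y; rewrite /flat ifT//; near: y; exact: lt_nbhsr.
  rewrite /flat x0.
  have dV : is_derive x (1 : R) (fun y : R => y^-1) (- x ^- 2 *: (1 : R)).
    by apply: is_deriveV; rewrite gt_eqF.
  have dP := @is_derive1_comp _ _ _ x _ _ (is_derive_poly P x^-1) dV.
  have dE := @is_derive1_comp _ expR _ x _ _ (is_derive_expR _) (is_deriveN dV).
  apply: is_derive_eq (is_deriveM dP dE) _.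
  rewrite /= !hornerE /= /GRing.scale /=.
  by field; rewrite gt_eqF.
(* At the origin the difference quotient is at most a constant times [x]. *)
- rewrite {2}/flat ltxx.
  have [C HC] := flat_le P.
  have flat0 : flat P 0 = 0 by rewrite /flat ltxx.
  suff dflat : h^-1 *: (flat P (h *: 1 + 0) - flat P 0) @[h --> 0^'] --> (0 : R).
    apply: DeriveDef; first by apply/cvg_ex; exists 0; exact: dflat.
    exact: cvg_lim dflat.
  apply/norm_cvg0P/(@squeeze_cvgr _ _ _ _ (cst 0) (fun h => C * `|h|)).
  - near=> h; rewrite normr_ge0/= flat0 subr0 addr0 [_%:A]mulr1 normrM normfV.
    have h0 : h != 0 by near: h; exact: nbhs_dnbhs_neq.
    rewrite ler_pdivrMl ?normr_gt0//; apply: le_trans (HC h) _.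
    by rewrite [leRHS]mulrCA -expr2 real_normK// num_real.
  - exact: cvg_cst.
  - rewrite -[X in _ --> X](mulr0 C); apply: cvgM; first exact: cvg_cst.
    rewrite -[X in _ --> X](@normr0 _ R); apply: cvg_norm.
    by apply: cvg_within_filter; exact: cvg_id.
Unshelve. all: by end_near. Qed.

End flat_function.

(** * Test functions on the annulus *)

Section test_functions.
Context {R : realType}.
Implicit Types (f g p : R * R -> R) (z v : R * R).

Lemma continuous_flat P : continuous (@flat R P).
Proof.
move=> x; apply/differentiable_continuous/derivable1_diffP.
by have [] := is_derive_flat P x.
Qed.

Lemma Ck_flat k P p : Ck k p -> Ck k (flat P \o p).
Proof.
elim: k P p => [|k IH] P p Cp; (split=> [z|//]; first by
  apply: continuous_comp; [exact: Ck_continuous Cp z|exact: continuous_flat]).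
have dflat z v : is_derive z v (flat P \o p)
    (flat ('X^2 * (P - P^`())) (p z) * 'D_v p z).
  apply: is_derive_chain; first exact: is_derive_flat.
  by apply: derivableP; exact: Ck_derivable Cp.
move=> v; split=> [z|]; first by have [] := dflat z v.
apply: Ck_eq (Ck_mul (IH ('X^2 * (P - P^`())) _ (CkW Cp)) (Ck_partial v Cp)).
by move=> z; rewrite /partial; have [_ ->] := dflat z v.
Qed.

Lemma smooth_partial f v : smooth f -> smooth (partial v f).
Proof. by move=> /smoothP sf; apply/smoothP => k; exact: Ck_partial. Qed.

Lemma smooth_mul f g : smooth f -> smooth g -> smooth (f \* g).
Proof. by move=> /smoothP sf /smoothP sg; apply/smoothP => k; exact: Ck_mul. Qed.

Lemma smooth_add f g : smooth f -> smooth g -> smooth (f \+ g).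
Proof. by move=> /smoothP sf /smoothP sg; apply/smoothP => k; exact: Ck_add. Qed.

Definition sqradius z : R := z.1 ^+ 2 + z.2 ^+ 2.

Lemma Ck_sqradius k : Ck k sqradius.
Proof.
apply: Ck_eq (Ck_add (Ck_mul (Ck_fst k) (Ck_fst k)) (Ck_mul (Ck_snd k) (Ck_snd k))).
by move=> z; rewrite /sqradius !expr2.
Qed.

Lemma continuous_sqradius : continuous sqradius.
Proof. exact: Ck_continuous (Ck_sqradius 0). Qed.

Context (delta : R) (delta_gt0 : 0 < delta).

Lemma annulusE z : annulus delta z <-> delta ^+ 2 <= sqradius z <= 1.
Proof.
rewrite /annulus /Defs.radius /= -/(sqradius z).
have r0 : 0 <= sqradius z by rewrite addr_ge0 ?sqr_ge0.
by rewrite -[in X in _ <-> X](sqr_sqrtr r0) -[in X in _ <-> is_true (_ && X)](expr1n _ 2)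
  !ler_pXn2r ?nnegrE ?sqrtr_ge0 ?ler01 // ltW.
Qed.

Lemma annulus_interiorE z :
  annulus_interior delta z <-> delta ^+ 2 < sqradius z < 1.
Proof.
rewrite /annulus_interior /Defs.radius /= -/(sqradius z).
have r0 : 0 <= sqradius z by rewrite addr_ge0 ?sqr_ge0.
by rewrite -[in X in _ <-> X](sqr_sqrtr r0) -[in X in _ <-> is_true (_ && X)](expr1n _ 2)
  !ltr_pXn2r ?nnegrE ?sqrtr_ge0 ?ler01 // ltW.
Qed.

Lemma closed_shell (a b : R) : closed [set z | a <= sqradius z <= b].
Proof.
rewrite (_ : mkset _ = sqradius @^-1` `[a, b]%classic); last first.
  by apply/seteqP; split => z /=; rewrite in_itv.
apply: preimage_closed; last exact: itv_closed.
by move=> z _; exact: continuous_sqradius.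
Qed.

Lemma compact_shell (a b : R) :
  b <= 1 -> compact [set z | a <= sqradius z <= b].
Proof.
move=> b1; apply: (@subclosed_compact _ _
  (`[(-1 : R), 1]%classic `*` `[(-1 : R), 1]%classic : set (R * R))).
- exact: closed_shell.
- by apply: compact_setX; exact: segment_compact.
- move=> z /andP[_ zb] /=; rewrite !in_itv /=.
  have := sqr_ge0 z.1; have := sqr_ge0 z.2; move: zb b1; rewrite /sqradius.
  by move=> ? ? ? ?; split; nra.
Qed.

(** The support is a closure: nonvanishing has to keep a margin [e] from the
    boundary circles for the support to be in the open annulus. *)
Lemma test_functionI f (e : R) : 0 < e -> smooth f ->
  (forall z, f z != 0 -> delta ^+ 2 + e <= sqradius z <= 1 - e) ->
  test_function delta f.
Proof.
move=> e0 sf fK.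
pose K := [set z | delta ^+ 2 + e <= sqradius z <= 1 - e].
have clfK : closure [set z | f z != 0] `<=` K.
  by move=> z /(closureS fK); rewrite -(closure_id K).1//; exact: closed_shell.
split => //.
  apply: subclosed_compact clfK; first exact: closed_closure.
  by apply: compact_shell; rewrite gerBl ltW.
by move=> z /clfK /andP[h1 h2]; apply/annulus_interiorE; apply/andP; split; lra.
Qed.

Lemma test_function_partial f v :
  test_function delta f -> test_function delta (partial v f).
Proof.
move=> [sf cf fi].
have cl : closure [set z | partial v f z != 0] `<=` closure [set z | f z != 0].
  rewrite [X in _ `<=` X](closure_id _).1; last exact: closed_closure.
  apply: closureS => z /=; apply: contraNP => nz.
  suff: 'D_v f z = 'D_v (cst 0) z by rewrite derive_cst => /eqP.
  apply: near_eq_derive.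
  have : nbhs z (~` closure [set z | f z != 0]).
    by apply: open_nbhs_nbhs; split => //; exact/closed_openC/closed_closure.
  apply: filterS => y ny; apply: contrapT => /eqP fy.
  by apply: ny; exact: subset_closure.
split; first exact: smooth_partial.
- by apply: subclosed_compact cl; first exact: closed_closure.
- exact: subset_trans fi.
Qed.

(** Multiplication by [n] makes the cutoff increase to the indicator of the
    positive reals; the shift by [1] keeps its support at distance [1/n] from [0]. *)
Definition cutoff (n : nat) (s : R) : R := flat 1 (n%:R * s - 1).

Lemma cutoff_ge0 n s : 0 <= cutoff n s.
Proof. by rewrite /cutoff /flat; case: ifPn => // _; rewrite hornerC mul1r expR_ge0. Qed.

Lemma cutoff_le1 n s : cutoff n s <= 1.
Proof.
rewrite /cutoff /flat; case: ifPn => // s0.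
by rewrite hornerC mul1r expR_le1 oppr_le0 invr_ge0 ltW.
Qed.

Lemma cutoff_neq0 n s : cutoff n s != 0 -> n.+1%:R^-1 <= s.
Proof.
rewrite /cutoff /flat; case: ifPn; last by rewrite eqxx.
case: n => [|n]; first by rewrite mul0r sub0r ltr0N1.
rewrite subr_gt0 => ns _.
rewrite -[leLHS]mul1r ler_pdivrMr ?ltr0n//.
have s0 : 0 < s.
  by move: (lt_trans ltr01 ns); rewrite pmulr_rgt0 ?ltr0n.
apply: (le_trans (ltW ns)); by rewrite mulrC ler_pM2l// ler_nat.
Qed.

Lemma cutoff_cvg s : cutoff n s @[n --> \oo] --> ((0 < s)%R%:R : R).
Proof.
have [s0|s0] := ltP 0 s; last first.
  apply: cvg_near_cst; apply: nearW => n.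
  rewrite /cutoff /flat ifF//; apply/negbTE; rewrite -leNgt.
  by rewrite lerBlDr add0r (le_trans _ ler01)// mulr_ge0_le0.
have inf : (n%:R * s - 1 : R) @[n --> \oo] --> +oo.
  apply/cvgryPge => A; near=> n.
  rewrite lerBrDr -ler_pdivrMr//; near: n; exact: nbhs_infty_ger.
have inv0 : (n%:R * s - 1 : R)^-1 @[n --> \oo] --> (0 : R).
  apply/gtr0_cvgV0 => //.
  by apply: cvgry_gt.
have -> : true%:R = expR (- 0) :> R by rewrite oppr0 expR0.
apply: (@cvg_trans _ (expR (- (n%:R * s - 1)^-1) @[n --> \oo])).
  apply: near_eq_cvg; near=> n; rewrite /cutoff /flat ifT ?hornerC ?mul1r//.
  by near: n; exact: cvgry_gt.
exact: cvg_comp (cvgN inv0) (@continuous_expR R (- 0)).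
Unshelve. all: by end_near. Qed.

(** A test function close to the indicator of the part of the open annulus that
    lies in the quadrant with corner [(a, c)]. *)
Definition window (n : nat) (a c : R) z : R :=
  cutoff n (z.1 - a) * cutoff n (z.2 - c) *
  (cutoff n (sqradius z - delta ^+ 2) * cutoff n (1 - sqradius z)).

Lemma test_function_window n a c : test_function delta (window n a c).
Proof.
apply: (@test_functionI _ n.+1%:R^-1); first by rewrite invr_gt0 ltr0n.
  have scut p : smooth p -> smooth (fun z => cutoff n (p z)).
    move=> /smoothP sp; apply/smoothP => k.
    apply: (Ck_flat 1 (p := fun z => n%:R * p z - 1)).
    exact: Ck_add (Ck_scale n%:R (sp k)) (Ck_cst k (- 1)).
  have sr : smooth sqradius by apply/smoothP; exact: Ck_sqradius.
  apply: smooth_mul; apply: smooth_mul; apply: scut; apply/smoothP => k.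
  - exact: Ck_add (Ck_fst k) (Ck_cst k (- a)).
  - exact: Ck_add (Ck_snd k) (Ck_cst k (- c)).
  - exact: Ck_add (Ck_sqradius k) (Ck_cst k (- delta ^+ 2)).
  - apply: Ck_eq (Ck_add (Ck_cst k 1) (Ck_scale (- 1) (Ck_sqradius k))) => z /=.
    by rewrite scaleN1r.
move=> z; rewrite !mulf_eq0 !negb_or => /andP[_ /andP[/cutoff_neq0 h1 /cutoff_neq0 h2]].
by rewrite addrC -lerBrDr h1 /= lerBrDl -lerBrDr.
Qed.

Lemma window_ge0 n a c z : 0 <= window n a c z.
Proof. by rewrite !mulr_ge0 ?cutoff_ge0. Qed.

Lemma window_le1 n a c z : window n a c z <= 1.
Proof. by rewrite !mulr_ile1 ?mulr_ge0 ?cutoff_ge0 ?cutoff_le1. Qed.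

Lemma window_cvg a c z : window n a c z @[n --> \oo] -->
  (([&& a < z.1, c < z.2, delta ^+ 2 < sqradius z & sqradius z < 1])%R%:R : R).
Proof.
rewrite -!mulnb !natrM mulrA -(subr_gt0 a) -(subr_gt0 c) -(subr_gt0 (delta ^+ 2)).
rewrite -(subr_gt0 (sqradius z)).
by apply: cvgM; apply: cvgM; exact: cutoff_cvg.
Qed.

End test_functions.

(** * Measurability and the fundamental theorem of calculus *)

Section plane_measurability.
Context {R : realType}.

(** An open subset of the plane is the union of the countably many squares with
    rational centre and radius that it contains. *)
Lemma open_measurable2 (U : set (R * R)) :
  open U -> measurable (U : set (measurableTypeR R * measurableTypeR R)).
Proof.
move=> oU.
pose B (e p q : rat) : set (measurableTypeR R * measurableTypeR R) :=
  [set z | (ball (ratr p : R) (ratr e) `*` ball (ratr q : R) (ratr e) `<=` U) /\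
     (ball (ratr p : R) (ratr e) `*` ball (ratr q : R) (ratr e)) z].
have -> : U = \bigcup_e \bigcup_p \bigcup_q B e p q.
  apply/seteqP; split=> [z Uz|z [e _ [p _ [q _ [BU Bz]]]]]; last exact: BU.
  have /nbhs_ballP[r /= r0 rU] : nbhs z U by exact: open_nbhs_nbhs.
  have [e /[!in_itv]/= /andP[e0 er]] := rat_in_itvoo (divr_gt0 r0 (ltr0n _ 2)).
  have /rat_in_itvoo[p /[!in_itv]/= /andP[p0 p1]] :
    z.1 - ratr e < z.1 + ratr e by lra.
  have /rat_in_itvoo[q /[!in_itv]/= /andP[q0 q1]] :
    z.2 - ratr e < z.2 + ratr e by lra.
  exists e => //; exists p => //; exists q => //; split.
    move=> y [/= y1 y2]; apply: rU; split => /=.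
      move: y1; rewrite /ball /= !ltr_norml => /andP[? ?]; apply/andP; split; lra.
    move: y2; rewrite /ball /= !ltr_norml => /andP[? ?]; apply/andP; split; lra.
  by split; rewrite /ball /= ltr_norml; apply/andP; split; lra.
apply: bigcupT_measurable_rat => e; apply: bigcupT_measurable_rat => p.
apply: bigcupT_measurable_rat => q.
have [BU|nBU] := pselect
  (ball (ratr p : R) (ratr e) `*` ball (ratr q : R) (ratr e) `<=` U).
  rewrite (_ : B e p q = ball (ratr p : R) (ratr e) `*` ball (ratr q : R) (ratr e)).
    by apply: measurableX; exact: measurable_ball.
  by apply/seteqP; split => z; [case|split].
rewrite (_ : B e p q = set0); first exact: measurable0.
by apply/seteqP; split => z // -[].
Qed.

Lemma continuous_measurable_fun2 (f : R * R -> R) : continuous f ->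
  measurable_fun setT (f : measurableTypeR R * measurableTypeR R -> R).
Proof.
move=> /continuousP cf; apply: (measurability _ (RGenOInfty.measurableE R)).
move=> /= _ [_ [x ->] <-]; rewrite setTI; apply: open_measurable2.
by apply: cf; exact: interval_open.
Qed.

End plane_measurability.

Section integral_of_derivative.
Context {R : realType}.

(** The fundamental theorem of calculus on an interval that contains the support
    in its interior. *)
Lemma integral_derive_compact (G g : R -> R) :
  (forall x : R, is_derive x (1 : R) G (g x)) -> continuous g ->
  (forall x, ~~ (- 1 <= x <= 1) -> G x = 0 /\ g x = 0) ->
  (\int[lebesgue_measure]_x (g x)%:E = 0)%E.
Proof.
move=> dG cg G0.
have dG1 x : derivable G x 1 by have [] := dG x.
have cG : continuous G.
  by move=> x; apply/differentiable_continuous/derivable1_diffP.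
have -> : (\int[lebesgue_measure]_x (g x)%:E =
    \int[lebesgue_measure]_(x in `[(-2 : R)%R, 2%R]) (g x)%:E)%E.
  rewrite [RHS]integral_mkcond; apply: eq_integral => x _.
  rewrite /patch; case: ifPn => // /negP xI.
  have [//|_ -> //] := G0 x.
  apply: contra_notN xI => /andP[x1 x2]; rewrite inE /= in_itv /=.
  by apply/andP; split; lra.
have [|G2 _] := G0 2%R; first by apply/negP => /andP[_]; lra.
have [|GN2 _] := G0 (- 2)%R; first by apply/negP => /andP[]; lra.
rewrite (@continuous_FTC2 _ g G) ?G2 ?GN2 ?subee //.
- by lra.
- exact: continuous_subspaceT.
- by split => [x _||]; [exact: dG1|apply: cvg_at_right_filter; exact: cG|
    apply: cvg_at_left_filter; exact: cG].
- by move=> x _; rewrite derive1E; have [_] := dG x.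
Qed.

End integral_of_derivative.

(** * Integration by parts on the annulus *)

Section annulus_integral.
Context {R : realType} (delta : R) (delta_gt0 : 0 < delta).
Implicit Types (f g p : R * R -> R) (z v : R * R).

Local Notation plane := (measurableTypeR R * measurableTypeR R)%type.
Local Notation lambda2 := (@lebesgue_measure R \x @lebesgue_measure R)%E.
Local Notation mu := (annulus_measure delta).

Lemma annulus_square z : annulus delta z ->
  (- 1 <= z.1 <= 1) && (- 1 <= z.2 <= 1).
Proof.
move=> /(annulusE delta_gt0)/andP[_]; rewrite /sqradius => z1.
have := sqr_ge0 z.1; have := sqr_ge0 z.2 => ? ?.
by apply/andP; split; apply/andP; split; nra.
Qed.

Lemma annulus_finite : (lambda2 (annulus delta) < +oo)%E.
Proof.
pose I : set (measurableTypeR R) := `[(-1 : R), 1]%classic.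
have mI : measurable I by exact: measurable_itv.
apply: (@le_lt_trans _ _ (lambda2 (I `*` I))).
  apply: le_measure; rewrite ?inE; [exact: measurable_annulus|exact: measurableX|].
  by move=> z /annulus_square/andP[z1 z2]; split; rewrite /I /= in_itv.
rewrite product_measure1E//= lebesgue_measure_itv /= lte_fin.
by case: ifP => _; rewrite -?EFinD -?EFinM ?mule0 ltry.
Qed.

Lemma annulus_measureE (A : set plane) :
  mu A = lambda2 (A `&` annulus delta).
Proof. by []. Qed.

Lemma annulus_measure_finite : (mu setT < +oo)%E.
Proof. by rewrite annulus_measureE setTI; exact: annulus_finite. Qed.

(** Integrals of functions supported in the annulus can be computed in the plane,
    where Fubini's theorem applies. *)
Lemma annulus_measure_restrict f : (forall z, ~ annulus delta z -> f z = 0) ->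
  (\int[mu]_z (f z)%:E = \int[lambda2]_z (f z)%:E)%E.
Proof.
move=> f0.
have fE : (EFin \o f) \_ (annulus delta) = EFin \o f.
  apply/funext => z; rewrite patchE; case: ifPn => //.
  by rewrite notin_setE => /f0 /= ->.
transitivity (\int[mu]_(z in annulus delta) (f z)%:E)%E.
  by rewrite [RHS]integral_mkcond fE.
transitivity (\int[lambda2]_(z in annulus delta) (f z)%:E)%E.
  apply: eq_measure_integral => A mA AD.
  by rewrite annulus_measureE setIidl.
by rewrite [LHS]integral_mkcond fE.
Qed.

Lemma bounded_on_annulus f : continuous f ->
  exists2 M, 0 <= M & forall z, annulus delta z -> `|f z| <= M.
Proof.
move=> cf.
have : compact (f @` (annulus delta)).
  apply: continuous_compact; first exact: continuous_subspaceT.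
  rewrite (_ : annulus delta = [set z | delta ^+ 2 <= sqradius z <= 1]).
    exact: compact_shell.
  by apply/seteqP; split => z /(annulusE delta_gt0).
move=> /compact_bounded[M [_ Mb]]; exists (`|M| + 1) => [|z Dz].
  by rewrite addr_ge0.
apply: (Mb (`|M| + 1)); last by exists z.
by rewrite (le_lt_trans (ler_norm M))// ltrDl.
Qed.

Lemma integrable_lambda2 f : continuous f ->
  (forall z, ~ annulus delta z -> f z = 0) ->
  lambda2.-integrable setT (EFin \o f).
Proof.
move=> cf f0.
rewrite (_ : EFin \o f = (EFin \o f) \_ (annulus delta)); last first.
  apply/funext => z; rewrite patchE; case: ifPn => //.
  by rewrite notin_setE => /f0 /= ->.
apply/(integrable_mkcond _ (measurable_annulus delta)).
apply: measurable_bounded_integrable.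
- exact: measurable_annulus.
- exact: annulus_finite.
- by apply: measurable_funTS; exact: continuous_measurable_fun2.
- have [M M0 HM] := bounded_on_annulus cf.
  exists M; split; first exact: num_real.
  by move=> N MN z Dz /=; apply: le_trans (ltW MN); exact: HM.
Qed.

Lemma integrable_annulus f : continuous f ->
  (forall z, ~ annulus delta z -> f z = 0) -> mu.-integrable setT (EFin \o f).
Proof.
move=> cf f0; apply: measurable_bounded_integrable => //.
- exact: annulus_measure_finite.
- exact: continuous_measurable_fun2.
- have [M M0 HM] := bounded_on_annulus cf.
  exists M; split; first exact: num_real.
  move=> N MN z _ /=; apply: le_trans (ltW MN).
  have [Dz|/f0 ->] := pselect (annulus delta z); first exact: HM.
  by rewrite normr0.
Qed.

Definition axis v := v = e_x \/ v = e_y.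

Lemma is_derive_slice1 f x y :
  derivable f (x, y) e_x -> is_derive x (1 : R) (fun s => f (s, y)) ('D_e_x f (x, y)).
Proof.
move=> df; have : (fun h : R => h^-1 *: (f ((h *: (1 : R) + x), y) - f (x, y))) =
   (fun h : R => h^-1 *: (f (h *: e_x + (x, y)) - f (x, y))).
  apply/funext => h; congr (_ *: (f _ - _)); apply/pair_equal_spec; split => //=.
  by rewrite [_ *: _]mulr0 add0r.
by move=> E; apply: DeriveDef; rewrite /derivable /derive /= /shift /= E.
Qed.

Lemma is_derive_slice2 f x y :
  derivable f (x, y) e_y -> is_derive y (1 : R) (fun s => f (x, s)) ('D_e_y f (x, y)).
Proof.
move=> df; have : (fun h : R => h^-1 *: (f (x, (h *: (1 : R) + y)) - f (x, y))) =
   (fun h : R => h^-1 *: (f (h *: e_y + (x, y)) - f (x, y))).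
  apply/funext => h; congr (_ *: (f _ - _)); apply/pair_equal_spec; split => //=.
  by rewrite [_ *: _]mulr0 add0r.
by move=> E; apply: DeriveDef; rewrite /derivable /derive /= /shift /= E.
Qed.

(** The complement of the annulus is open, so vanishing there is inherited by
    derivatives. *)
Lemma partial_eq0 f v : (forall z, ~ annulus delta z -> f z = 0) ->
  forall z, ~ annulus delta z -> partial v f z = 0.
Proof.
move=> f0 z nz.
have clD : closed (annulus delta : set (R * R)).
  rewrite (_ : annulus delta = [set z | delta ^+ 2 <= sqradius z <= 1]).
    exact: closed_shell.
  by apply/seteqP; split => y /(annulusE delta_gt0).
rewrite /partial (@near_eq_derive _ _ _ _ (cst 0)) ?derive_cst//.
have : nbhs z (~` annulus delta).
  by apply: open_nbhs_nbhs; split => //; exact: closed_openC.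
by apply: filterS => y /f0.
Qed.

(** By Fubini's theorem the integral is an iterated one, whose inner integral, along
    the direction of the derivative, is that of the derivative of a compactly
    supported function. *)
Lemma integral_partial f v : axis v -> Ck 1 f ->
  (forall z, ~ annulus delta z -> f z = 0) ->
  (\int[mu]_z (partial v f z)%:E = 0)%E.
Proof.
move=> Av Cf f0; have g0 := @partial_eq0 _ v f0.
have cg : continuous (partial v f) by exact: Ck_continuous (Ck_partial v Cf).
have ig := integrable_lambda2 cg g0.
rewrite annulus_measure_restrict//.
case: Av => vE; subst v.
  (* Integrate first in the variable of differentiation. *)
  rewrite -(integral21_prod_meas1 ig) integral0_eq// => y _.
  apply: (@integral_derive_compact _ (fun x => f (x, y))).
  - by move=> x; apply: is_derive_slice1; exact: Ck_derivable Cf.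
  - move=> x; apply: (cvg_comp (fun x => (x, y)) (partial e_x f)); last exact: cg.
    by apply: (@cvg_pair _ _ _ _ (nbhs x) (nbhs y)); [exact: cvg_id|exact: cvg_cst].
  - move=> x nx; have nD : ~ annulus delta (x, y).
      by move=> /annulus_square/andP[/= h _]; rewrite h in nx.
    by rewrite f0// g0.
rewrite -(integral12_prod_meas1 ig) integral0_eq// => x _.
apply: (@integral_derive_compact _ (fun y => f (x, y))).
- by move=> y; apply: is_derive_slice2; exact: Ck_derivable Cf.
- move=> y; apply: (cvg_comp (fun y => (x, y)) (partial e_y f)); last exact: cg.
  by apply: (@cvg_pair _ _ _ _ (nbhs x) (nbhs y)); [exact: cvg_cst|exact: cvg_id].
- move=> y ny; have nD : ~ annulus delta (x, y).
    by move=> /annulus_square/andP[/= _ h]; rewrite h in ny.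
  by rewrite f0// g0.
Qed.

Lemma test_function_eq0 f : test_function delta f ->
  forall z, ~ annulus delta z -> f z = 0.
Proof.
move=> [_ _ fi] z nz; apply: contrapT => /eqP fz; apply: nz.
have /fi /andP[z1 z2] : closure [set z | f z != 0] z by exact: subset_closure.
by apply/andP; split; exact: ltW.
Qed.

(** Integration by parts: the product of [f] with a test function is supported in
    the annulus, hence the integral of its derivative is zero. No boundary
    condition on [f] is involved, as the test function carries the support. *)
Lemma weak_derivative_partial f v : axis v -> Ck 1 f ->
  weak_derivative delta v f (partial v f).
Proof.
move=> Av Cf phi tphi; have [/smoothP sphi _ _] := tphi.
have phi0 := test_function_eq0 tphi.
have dphi0 := @partial_eq0 _ v phi0.
have cf := Ck_continuous Cf.
have cphi := Ck_continuous (sphi 0%N).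
have cdphi : continuous (partial v phi) by exact: Ck_continuous (Ck_partial v (sphi 1%N)).
have cdf : continuous (partial v f) by exact: Ck_continuous (Ck_partial v Cf).
have int0 : (\int[mu]_z (partial v (f \* phi) z)%:E = 0)%E.
  apply: integral_partial Av (Ck_mul Cf (sphi 1%N)) _ => z nz /=.
  by rewrite phi0 ?mulr0.
have i1 : mu.-integrable setT (EFin \o (fun z => f z * partial v phi z)).
  apply: integrable_annulus => [z|z nz]; last by rewrite dphi0 ?mulr0.
  by apply: cvgM; [exact: cf|exact: cdphi].
have i2 : mu.-integrable setT (EFin \o (fun z => partial v f z * phi z)).
  apply: integrable_annulus => [z|z nz]; last by rewrite phi0 ?mulr0.
  by apply: cvgM; [exact: cdf|exact: cphi].
apply/eqP; rewrite -subr_eq0 opprK; apply/eqP.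
rewrite -RintegralD// /Rintegral.
rewrite [X in fine X](_ : _ = 0%E)// -[RHS]int0.
apply: eq_integral => z _; congr EFin.
rewrite /partial /= deriveM; first by rewrite [phi z *: _]mulrC.
- exact: Ck_derivable Cf.
- exact: Ck_derivable (sphi 1%N).
Qed.

End annulus_integral.

(** * The displacement of a contraction semigroup *)

Section L2_norm.
Context {R : realType} (delta : R).
Implicit Types (f g h : L2 delta).

Local Notation mu := (annulus_measure delta).

Lemma ae_imp (P Q : R * R -> Prop) : (forall z, P z -> Q z) ->
  (\forall z \ae mu, P z) -> \forall z \ae mu, Q z.
Proof. by move=> PQ; apply: (@filterS _ _ (ae_filter_ringOfSetsType mu)). Qed.

Lemma aeW (P : R * R -> Prop) : (forall z, P z) -> \forall z \ae mu, P z.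
Proof.
move=> HP; apply: (@filterS _ _ (ae_filter_ringOfSetsType mu) setT) => //.
exact: (@filterT _ _ (ae_filter_ringOfSetsType mu)).
Qed.

Lemma ae_imp2 (P Q S : R * R -> Prop) : (forall z, P z -> Q z -> S z) ->
  (\forall z \ae mu, P z) -> (\forall z \ae mu, Q z) -> \forall z \ae mu, S z.
Proof. by move=> PQS; apply: (@filterS2 _ _ (ae_filter_ringOfSetsType mu)). Qed.

Lemma L2D f g z : (f + g) z = f z + g z. Proof. by []. Qed.
Lemma L2N f z : (- f) z = - f z. Proof. by []. Qed.
Lemma L2Z (a : R) f z : (a *: f) z = a * f z. Proof. by []. Qed.
Lemma L2_0 z : (0 : L2 delta) z = 0. Proof. by []. Qed.
Definition L2E := (L2D, L2N, L2Z, L2_0).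

Definition norm2 f : R := fine (L2norm delta f).

Lemma norm2E f : (norm2 f)%:E = L2norm delta f.
Proof. exact: finite_norm_fine. Qed.

Lemma norm2_ge0 f : 0 <= norm2 f.
Proof. by rewrite /norm2 fine_ge0// Lnorm_ge0. Qed.

Lemma norm2D f g : norm2 (f + g) <= norm2 f + norm2 g.
Proof. exact: ler_LnormD. Qed.

Lemma norm2Z (a : R) f : norm2 (a *: f) = `|a| * norm2 f.
Proof. by apply: EFin_inj; rewrite norm2E EFinM norm2E; exact: LnormZ. Qed.

Lemma norm2N f : norm2 (- f) = norm2 f.
Proof. by rewrite -scaleN1r norm2Z normrN1 mul1r. Qed.

Lemma L2normE (f : R * R -> R) :
  L2norm delta f = ((\int[mu]_z (f z ^+ 2)%:E) `^ 2^-1)%E.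
Proof.
rewrite /L2norm unlock; congr (_ `^ _)%E; apply: eq_integral => z _.
by rewrite /= powR_mulrn// real_normK// num_real.
Qed.

Lemma L2norm_ae (f g : R * R -> R) :
  measurable_fun setT (f : measurableTypeR R * measurableTypeR R -> R) ->
  measurable_fun setT (g : measurableTypeR R * measurableTypeR R -> R) ->
  L2eq delta f g -> L2norm delta f = L2norm delta g.
Proof.
move=> mf mg fg; rewrite !L2normE; congr (_ `^ _)%E.
apply: ae_eq_integral => //.
- by apply/measurable_EFinP; exact: measurable_funX.
- by apply/measurable_EFinP; exact: measurable_funX.
- by apply: ae_imp fg => z /= -> _.
Qed.

Lemma norm2_ae f g : L2eq delta f g -> norm2 f = norm2 g.
Proof. by move=> fg; rewrite /norm2 (@L2norm_ae f g). Qed.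

End L2_norm.

Section contraction_semigroup.
Context {R : realType} (delta : R) (S : R -> L2 delta -> L2 delta).
Context (CS : C0_contraction_semigroup S).
Implicit Types (f g h : L2 delta) (s t : R).

Lemma semigroupB t f g : 0 <= t -> L2eq delta (S t (f - g)) (S t f - S t g).
Proof.
move=> t0; have [lin _ _ _ _] := CS.
have := lin t (-1) g f t0; apply: ae_imp => z.
by rewrite addrC scaleN1r => ->; rewrite !L2E; ring.
Qed.

Lemma semigroup_contract t f : 0 <= t -> norm2 (S t f) <= norm2 f.
Proof. by move=> t0; have [_ _ _ C _] := CS; rewrite -lee_fin !norm2E C. Qed.

(** Write [S (s + t) f - f = (S s f - f) + S s (S t f - f)] and contract the last
    term: the displacement is subadditive in time. *)
Lemma semigroup_displacementD s t f : 0 <= s -> 0 <= t ->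
  norm2 (S (s + t) f - f) <= norm2 (S s f - f) + norm2 (S t f - f).
Proof.
move=> s0 t0; have [_ _ add _ _] := CS.
rewrite (@norm2_ae _ _ _ ((S s f - f) + S s (S t f - f))); last first.
  move: (add s t f s0 t0) (semigroupB (S t f) f s0); apply: ae_imp2 => z.
  by rewrite !L2E => -> ->; ring.
by apply: le_trans (norm2D _ _) _; rewrite lerD2l semigroup_contract.
Qed.

Lemma semigroup_displacementMn n t f : 0 <= t ->
  norm2 (S (n%:R * t) f - f) <= n%:R * norm2 (S t f - f).
Proof.
move=> t0; have [_ S0 _ _ _] := CS; elim: n => [|n IH].
  rewrite !mul0r (@norm2_ae _ _ _ 0).
    by rewrite -(scale0r f) norm2Z normr0 mul0r.
  by move: (S0 f); apply: ae_imp => z; rewrite !L2E => ->; rewrite subrr.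
have natSM (x : R) : n.+1%:R * x = n%:R * x + x by rewrite -natr1 mulrDl mul1r.
rewrite !natSM.
apply: le_trans (semigroup_displacementD _ _ _) _ => //.
  by rewrite mulr_ge0.
by rewrite lerD2r.
Qed.

(** Split the time [t] into [n] steps: by subadditivity the displacement is at most
    [n] times the displacement at time [t / n], which the definition of the generator
    compares with [t / n] times the norm of [g]. This replaces the usual integral
    of [S s g] over [0 <= s <= t], and needs no integration of [L^2]-valued maps. *)
Lemma generator_displacement f g t : generator_graph S f g -> 0 <= t ->
  norm2 (S t f - f) <= t * norm2 g.
Proof.
rewrite le_eqVlt => Gfg /predU1P[<-|t0].
  by have := semigroup_displacementMn 0 f (lexx 0); rewrite !mul0r.
apply/ler_addgt0Pr => e e0.
have et0 : 0 < e / t by rewrite divr_gt0.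
have : \forall s \near 0^'+, norm2 (S s f - f) <= s * (norm2 g + e / t).
  have : \forall s \near 0^'+,
      (L2norm delta (s^-1 *: (S s f - f) - g)%R < (e / t)%:E)%E.
    have nb : nbhs (0%E : \bar R) (fun x => (x < (e / t)%:E)%E).
      by apply: open_ereal_lt'; rewrite lte_fin.
    exact: (Gfg _ nb).
  move=> Hs; near=> s.
  have s0 : 0 < s by [].
  have : norm2 (s^-1 *: (S s f - f) - g) < e / t.
    by rewrite -lte_fin norm2E; near: s.
  move=> /ltW H; rewrite -ler_pdivrMl// -(gtr0_norm s0) -normfV -norm2Z.
  rewrite gtr0_norm// -[X in norm2 X](subrK g) addrC.
  by apply: le_trans (norm2D _ _) _; rewrite lerD2l.
move=> [r /= r0 Hr].
(* [r] is the range of times where the estimate holds; [n] is such that [t / n < r]. *)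
pose n := (Num.truncn (t / r)).+1.
have n0 : 0 < n%:R :> R by rewrite ltr0n.
have tn0 : 0 < t / n%:R by rewrite divr_gt0.
have := Hr (t / n%:R).
rewrite /= sub0r normrN gtr0_norm// => /(_ _ tn0) H.
have tE : t = n%:R * (t / n%:R) by rewrite mulrC divfK// gt_eqF.
rewrite {1}tE; apply: le_trans (semigroup_displacementMn _ _ (ltW tn0)) _.
apply: (@le_trans _ _ (n%:R * (t / n%:R * (norm2 g + e / t)))).
  rewrite ler_pM2l//; apply: H.
  rewrite ltr_pdivrMr// mulrC -ltr_pdivrMr//.
  exact: truncnS_gt.
rewrite mulrA -tE mulrDr mulrCA divff ?mulr1//; rewrite gt_eqF//.
Unshelve. all: by end_near. Qed.

(** The error committed in replacing [u] by [f] counts twice: at time [0], and at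
    time [t], where the semigroup does not amplify it. *)
Lemma displacement_le u f g t : generator_graph S f g -> 0 <= t ->
  norm2 (S t u - u) <= 2 * norm2 (u - f) + t * norm2 g.
Proof.
move=> Gfg t0.
rewrite (@norm2_ae _ _ _ (S t (u - f) + ((S t f - f) - (u - f)))); last first.
  move: (semigroupB u f t0); apply: ae_imp => z.
  by rewrite !L2E => ->; ring.
apply: le_trans (norm2D _ _) _.
have := semigroup_contract (u - f) t0.
have := norm2D (S t f - f) (- (u - f)); rewrite norm2N.
have := generator_displacement Gfg t0.
lra.
Qed.

End contraction_semigroup.

(** * The viscous operator on test functions *)

Section smooth_quotient.
Context {R : realType}.
Implicit Types (f g p : R * R -> R) (z v : R * R).

Lemma Ck_inv k p : (forall z, p z != 0) -> Ck k p -> Ck k (fun z => (p z)^-1).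
Proof.
move=> p0; elim: k => [|k IH] Cp; (split=> [z|//]; first by
  apply: cvgV; [exact: p0|exact: Ck_continuous Cp z]).
move=> v; split=> [z|]; first by apply: derivableV; [exact: p0|exact: Ck_derivable Cp].
have Ci := IH (CkW Cp).
apply: Ck_eq (Ck_scale (- 1) (Ck_mul (Ck_mul Ci Ci) (Ck_partial v Cp))) => z.
rewrite /partial deriveV//; last exact: Ck_derivable Cp.
by rewrite /= /GRing.scale /= expr2 invfM mulN1r mulNr.
Qed.

Lemma smooth_inv p : (forall z, p z != 0) -> smooth p -> smooth (fun z => (p z)^-1).
Proof. by move=> p0 /smoothP sp; apply/smoothP => k; exact: Ck_inv. Qed.

Lemma partial_lincomb v (a b : R) f g z : Ck 1 f -> Ck 1 g ->
  partial v (a \*: f \+ b \*: g) z = a * partial v f z + b * partial v g z.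
Proof.
move=> Cf Cg; have df : derivable f z v by exact: Ck_derivable Cf.
have dg : derivable g z v by exact: Ck_derivable Cg.
have daf : derivable (a \*: f) z v by exact: derivableZ.
have dbg : derivable (b \*: g) z v by exact: derivableZ.
by rewrite /partial (deriveD daf dbg) (deriveZ _ df) (deriveZ _ dg).
Qed.

Context (delta : R) (delta_gt0 : 0 < delta).

Lemma test_functionMl g f : smooth g -> test_function delta f ->
  test_function delta (g \* f).
Proof.
move=> sg [sf cf fi].
have cl : closure [set z | (g \* f) z != 0] `<=` closure [set z | f z != 0].
  by apply: closureS => z /=; rewrite mulf_eq0 negb_or => /andP[].
split; first exact: smooth_mul.
- by apply: subclosed_compact cl; first exact: closed_closure.
- exact: subset_trans fi.
Qed.

Lemma test_functionD f g : test_function delta f -> test_function delta g ->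
  test_function delta (f \+ g).
Proof.
move=> [sf cf fi] [sg cg gi].
have cl : closure [set z | (f \+ g) z != 0] `<=`
    closure [set z | f z != 0] `|` closure [set z | g z != 0].
  rewrite -closureU; apply: closureS => z /=.
  have [->|] := eqVneq (f z) 0; last by left.
  by rewrite add0r; right.
split; first exact: smooth_add.
- by apply: subclosed_compact cl; [exact: closed_closure|exact: compactU].
- by apply: subset_trans cl _; rewrite subUset.
Qed.

(** The squared radius, modified in the hole of the annulus so as to vanish nowhere
    while remaining smooth. The entries of [J] are then restrictions of smooth
    functions on the plane. *)
Definition sqradius_reg z : R := sqradius z + flat 1 (delta ^+ 2 - sqradius z).

Lemma sqradius_reg_neq0 z : sqradius_reg z != 0.
Proof.
have r0 : 0 <= sqradius z by rewrite addr_ge0 ?sqr_ge0.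
rewrite gt_eqF// /sqradius_reg /flat subr_gt0 hornerC mul1r.
case: ifPn => [_|]; first by rewrite ltr_wpDl// expR_gt0.
by rewrite -leNgt addr0 => /(lt_le_trans _); apply; rewrite exprn_gt0.
Qed.

Lemma sqradius_regE z : annulus delta z -> sqradius_reg z = sqradius z.
Proof.
move=> /(annulusE delta_gt0)/andP[rz _].
by rewrite /sqradius_reg /flat subr_gt0 ltNge rz /= addr0.
Qed.

Lemma smooth_sqradius_reg : smooth sqradius_reg.
Proof.
apply/smoothP => k; apply: Ck_add; first exact: Ck_sqradius.
apply: (Ck_flat 1 (p := fun z => delta ^+ 2 - sqradius z)).
apply: Ck_eq (Ck_add (Ck_cst k (delta ^+ 2)) (Ck_scale (- 1) (Ck_sqradius k))) => z /=.
by rewrite scaleN1r.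
Qed.

Lemma smooth_fst : smooth (fst : R * R -> R).
Proof. by apply/smoothP => k; exact: Ck_fst. Qed.

Lemma smooth_snd : smooth (snd : R * R -> R).
Proof. by apply/smoothP => k; exact: Ck_snd. Qed.

(** Smooth functions on the plane that agree on the annulus with the products of
    the sine and cosine of the polar angle. *)
Definition cos_sqr z : R := z.1 * z.1 * (sqradius_reg z)^-1.
Definition sin_sqr z : R := z.2 * z.2 * (sqradius_reg z)^-1.
Definition sin_cos z : R := z.2 * z.1 * (sqradius_reg z)^-1.

Lemma smooth_cos_sqr : smooth cos_sqr.
Proof.
by do !apply: smooth_mul; [exact: smooth_fst..|
  exact: smooth_inv sqradius_reg_neq0 smooth_sqradius_reg].
Qed.

Lemma smooth_sin_sqr : smooth sin_sqr.
Proof.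
by do !apply: smooth_mul; [exact: smooth_snd..|
  exact: smooth_inv sqradius_reg_neq0 smooth_sqradius_reg].
Qed.

Lemma smooth_sin_cos : smooth sin_cos.
Proof.
by do !apply: smooth_mul; [exact: smooth_snd|exact: smooth_fst|
  exact: smooth_inv sqradius_reg_neq0 smooth_sqradius_reg].
Qed.

Lemma radius_sqr z : Defs.radius z ^+ 2 = sqradius z.
Proof. by rewrite sqr_sqrtr// addr_ge0 ?sqr_ge0. Qed.

Lemma J_xxE (nu : R * R) z : annulus delta z ->
  J_xx nu z = nu.1 * cos_sqr z + nu.2 * sin_sqr z.
Proof.
move=> Dz; rewrite /J_xx /cos_angle /sin_angle /cos_sqr /sin_sqr.
rewrite (sqradius_regE Dz) -radius_sqr.
by rewrite !exprMn !exprVn !expr2.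
Qed.

Lemma J_xyE (nu : R * R) z : annulus delta z ->
  J_xy nu z = nu.1 * sin_cos z - nu.2 * sin_cos z.
Proof.
move=> Dz; rewrite /J_xy /cos_angle /sin_angle /sin_cos (sqradius_regE Dz) -radius_sqr.
by rewrite expr2 invfM; ring.
Qed.

Lemma J_yyE (nu : R * R) z : annulus delta z ->
  J_yy nu z = nu.1 * sin_sqr z + nu.2 * cos_sqr z.
Proof.
move=> Dz; rewrite /J_yy /cos_angle /sin_angle /cos_sqr /sin_sqr.
rewrite (sqradius_regE Dz) -radius_sqr.
by rewrite !exprMn !exprVn !expr2.
Qed.

End smooth_quotient.

Section operator_on_test_functions.
Context {R : realType} (delta : R) (delta_gt0 : 0 < delta).
Implicit Types (f g p : R * R -> R) (z v : R * R) (u : L2 delta).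

Local Notation mu := (annulus_measure delta).

Lemma L2norm_test_lty f : test_function delta f -> (L2norm delta f < +oo)%E.
Proof.
move=> tf; have [/smoothP sf _ _] := tf.
have cf := Ck_continuous (sf 0%N).
have f0 := test_function_eq0 tf.
rewrite L2normE poweR_lty//.
have /integrableP[_] : mu.-integrable setT (EFin \o (f \* f)).
  apply: integrable_annulus => // [z|z nz]; last by rewrite /= f0 ?mulr0.
  by apply: cvgM; exact: cf.
apply: le_lt_trans; apply: ge0_le_integral => //.
- by move=> z _; rewrite lee_fin sqr_ge0.
- by apply/measurable_EFinP; apply: measurable_funX; exact: continuous_measurable_fun2.
- apply: measurableT_comp => //; apply/measurable_EFinP.
  by apply: measurable_funM; exact: continuous_measurable_fun2.
- by move=> z _; rewrite [leRHS]/= lee_fin expr2; exact: ler_norm.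
Qed.

Lemma L2_test f : test_function delta f -> exists u, (u : R * R -> R) = f.
Proof.
move=> tf; have [/smoothP sf _ _] := tf.
have cf := Ck_continuous (sf 0%N).
have Lf : f \in Lfun mu 2%:E.
  apply/andP; split; apply: mem_set; last exact: L2norm_test_lty.
  exact: continuous_measurable_fun2.
by exists (Lfun_Sub (lee1n 2) Lf).
Qed.

(** Test functions and their derivatives vanish off the annulus, so a weak
    derivative only sees values taken on it. *)
Lemma weak_derivative_eq v f f' g g' :
  (forall z, annulus delta z -> f z = f' z) ->
  (forall z, annulus delta z -> g z = g' z) ->
  weak_derivative delta v f g -> weak_derivative delta v f' g'.
Proof.
move=> ff' gg' wf phi tphi.
have phi0 := test_function_eq0 tphi.
have dphi0 := test_function_eq0 (test_function_partial v tphi).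
transitivity (\int[mu]_z (f z * 'D_v phi z)).
  apply: eq_Rintegral => z _; have [/ff' -> //|nz] := pselect (annulus delta z).
  by have := dphi0 _ nz; rewrite /partial => ->; rewrite !mulr0.
rewrite wf//; congr (- _); apply: eq_Rintegral => z _.
have [/gg' -> //|nz] := pselect (annulus delta z).
by rewrite phi0// !mulr0.
Qed.

Lemma weak_derivative_test v f u g : axis v -> test_function delta f ->
  (u : R * R -> R) = f -> g = partial v f -> weak_derivative delta v u g.
Proof.
move=> Av [/smoothP sf _ _] -> ->; exact: weak_derivative_partial (sf 1%N).
Qed.

Lemma sobolev_H1_test f u : test_function delta f -> (u : R * R -> R) = f ->
  sobolev_H1 u.
Proof.
move=> tf uf.
have [gx gxE] := L2_test (test_function_partial e_x tf).
have [gy gyE] := L2_test (test_function_partial e_y tf).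
exists gx, gy; split.
  by apply: (weak_derivative_test _ tf) => //; left.
by apply: (weak_derivative_test _ tf) => //; right.
Qed.

(** The entries of [J] are linear in the two viscosities, and so is the flux
    [J grad f]; its divergence is therefore a combination [nu.1 g1 + nu.2 g2] of two
    functions that do not depend on [nu]. Being the derivatives of test functions,
    they belong to [L^2]. *)
Lemma A_graph_test f u : test_function delta f -> (u : R * R -> R) = f ->
  exists g1 g2 : L2 delta, forall nu, A_graph nu u (nu.1 *: g1 + nu.2 *: g2).
Proof.
move=> tf uf.
have tfx := test_function_partial e_x tf.
have tfy := test_function_partial e_y tf.
have [gx gxE] := L2_test tfx; have [gy gyE] := L2_test tfy.
have wx : weak_derivative delta e_x u gx.
  by apply: (weak_derivative_test _ tf) => //; left.
have wy : weak_derivative delta e_y u gy.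
  by apply: (weak_derivative_test _ tf) => //; right.
have flux v (c d : R * R -> R) : smooth c -> smooth d ->
  exists h : L2 delta,
    (h : R * R -> R) = partial v (c \* partial e_x f \+ d \* partial e_y f).
  move=> sc sd; apply: L2_test; apply: test_function_partial.
  by apply: test_functionD; exact: test_functionMl.
have sA := smooth_cos_sqr delta_gt0; have sB := smooth_sin_sqr delta_gt0.
have sC := smooth_sin_cos delta_gt0.
(* [nu.2] enters the off-diagonal entries of [J] with the opposite sign *)
have sNC : smooth (- 1 \*: sin_cos delta).
  by apply/smoothP => k; apply: Ck_scale; move: k; exact/smoothP.
have [a1 a1E] := flux e_x _ _ sA sC.
have [a2 a2E] := flux e_x _ _ sB sNC.
have [b1 b1E] := flux e_y _ _ sC sB.
have [b2 b2E] := flux e_y _ _ sNC sA.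
exists (a1 + b1), (a2 + b2) => nu; split.
- exists gx, gy; split => //.
    exact (sobolev_H1_test tfx gxE).
  exact (sobolev_H1_test tfy gyE).
(* [f], being a test function, is its own approximation in [H^1_0] *)
- exists gx, gy; split => // e e0; exists f.
  have L0 (h : R * R -> R) : (forall z, h z = 0) -> (L2norm delta h < e%:E)%E.
    move=> h0; rewrite (_ : L2norm delta h = 0)%E ?lte_fin//.
    rewrite -(@Lnorm0 _ _ _ mu 2%:E)//; congr (Lnorm _ _ _).
    by apply/funext => z /=; rewrite h0.
  by split => //; apply: L0 => z; rewrite ?uf ?gxE ?gyE /partial subrr.
have wflux v (c1 d1 c2 d2 : R * R -> R) : axis v ->
    smooth c1 -> smooth d1 -> smooth c2 -> smooth d2 ->
    weak_derivative delta v
      (fun z => (nu.1 * c1 z + nu.2 * c2 z) * gx z + (nu.1 * d1 z + nu.2 * d2 z) * gy z)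
      (fun z => nu.1 * partial v (c1 \* partial e_x f \+ d1 \* partial e_y f) z +
                nu.2 * partial v (c2 \* partial e_x f \+ d2 \* partial e_y f) z).
  move=> Av sc1 sd1 sc2 sd2; rewrite gxE gyE.
  have Cflux (c d : R * R -> R) : smooth c -> smooth d ->
      Ck 1 (c \* partial e_x f \+ d \* partial e_y f).
    move=> /smoothP sc /smoothP sd; have [/smoothP sfx _ _] := tfx.
    by have [/smoothP sfy _ _] := tfy; apply: Ck_add; exact: Ck_mul.
  have C1 := Cflux _ _ sc1 sd1; have C2 := Cflux _ _ sc2 sd2.
  have := weak_derivative_partial delta_gt0 Av
    (Ck_add (Ck_scale nu.1 C1) (Ck_scale nu.2 C2)).
  apply: weak_derivative_eq => z _; last exact: partial_lincomb.
  rewrite /= /GRing.scale /=; move: (partial e_x f z) (partial e_y f z) => ? ?.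
  ring.
exists gx, gy, (nu.1 *: a1 + nu.2 *: a2), (nu.1 *: b1 + nu.2 *: b2); split => //.
- have := wflux e_x _ _ _ _ (or_introl erefl) sA sC sB sNC.
  apply: weak_derivative_eq => z Dz; last by rewrite !L2E a1E a2E.
  by rewrite (J_xxE delta_gt0)// (J_xyE delta_gt0)//= scaleN1r mulrN.
- have := wflux e_y _ _ _ _ (or_intror erefl) sC sB sNC sA.
  apply: weak_derivative_eq => z Dz; last by rewrite !L2E b1E b2E.
  by rewrite (J_yyE delta_gt0)// (J_xyE delta_gt0)//= scaleN1r mulrN.
- by apply: aeW => z; rewrite !L2E; ring.
Qed.

End operator_on_test_functions.

(** * Functions approximable by test functions *)

Section approximation.
Context {R : realType} (delta : R) (delta_gt0 : 0 < delta).

Local Notation plane := (measurableTypeR R * measurableTypeR R)%type.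
Local Notation mu := (annulus_measure delta).
Implicit Types (f g h : plane -> R) (A B C : set plane).

Lemma L2norm_ltP f (e : R) : 0 < e ->
  (\int[mu]_z (f z ^+ 2)%:E < (e ^+ 2)%:E)%E -> (L2norm delta f < e%:E)%E.
Proof.
move=> e0; rewrite L2normE.
have : (0 <= \int[mu]_z (f z ^+ 2)%:E)%E.
  by apply: integral_ge0 => z _; rewrite lee_fin sqr_ge0.
case: (\int[mu]_z _)%E => // r; rewrite lee_fin => r0.
rewrite poweR_EFin powR12_sqrt// !lte_fin => re.
by rewrite -(gtr0_norm e0) -sqrtr_sqr ltr_sqrt// exprn_gt0.
Qed.

(** Unlike the triangle inequality for elements of [L^2], this one applies to
    functions that are merely measurable, with infinite norms allowed. *)
Lemma L2norm_triangle f g : measurable_fun setT f -> measurable_fun setT g ->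
  (L2norm delta (fun z => f z + g z)%R <= L2norm delta f + L2norm delta g)%E.
Proof. by move=> mf mg; apply: eminkowski => //; rewrite lee1n. Qed.

(** Dominated convergence applied to the squares. *)
Lemma L2norm_dominated (f_ : (plane -> R)^nat) g (e : R) : 0 < e ->
  (forall n, measurable_fun setT (f_ n)) ->
  (\forall z \ae mu, f_ n z @[n --> \oo] --> (0 : R)) ->
  mu.-integrable setT (fun z => (g z ^+ 2)%:E) ->
  (forall n z, `|f_ n z| <= `|g z|) ->
  exists n, (L2norm delta (f_ n) < e%:E)%E.
Proof.
move=> e0 mf f0 ig fg.
have mf2 n : measurable_fun setT (fun z => (f_ n z ^+ 2)%:E).
  by apply/measurable_EFinP; exact: measurable_funX.
have f20 : {ae mu, forall z, setT z -> (f_ n z ^+ 2)%:E @[n --> \oo] --> 0%E}.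
  apply: ae_imp f0 => z fz _; apply: cvg_EFin; first exact: nearW.
  rewrite -(mulr0 (0 : R)) (_ : fine \o _ = (fun n => f_ n z * f_ n z)).
    by apply: cvgM.
  by apply/funext => n; rewrite /= expr2.
have f2g : {ae mu, forall z n, setT z -> (`|(f_ n z ^+ 2)%:E| <= (g z ^+ 2)%:E)%E}.
  apply: aeW => z n _.
  rewrite /= lee_fin ger0_norm ?sqr_ge0// -[leLHS]real_normK ?num_real//.
  by rewrite -[leRHS]real_normK ?num_real// lerXn2r ?nnegrE.
have [_ _] := dominated_convergence measurableT mf2 (measurable_cst 0%E) f20 ig f2g.
rewrite integral0 => H.
have nb : nbhs (0%E : \bar R) (fun x => (x < (e ^+ 2)%:E)%E).
  by apply: open_ereal_lt'; rewrite lte_fin exprn_gt0.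
have [N _ HN] := H _ nb.
by exists N; apply: L2norm_ltP => //; apply: HN => /=.
Qed.

Definition approximable f := measurable_fun setT f /\
  forall e : R, 0 < e -> exists phi, test_function delta phi /\
    (L2norm delta (fun z => f z - phi z)%R < e%:E)%E.

Lemma measurable_test phi : test_function delta phi ->
  measurable_fun setT (phi : plane -> R).
Proof.
move=> [/smoothP s _ _]; apply: continuous_measurable_fun2.
exact: Ck_continuous (s 0%N).
Qed.

Lemma approximable_limit f : measurable_fun setT f ->
  (forall e : R, 0 < e -> exists2 g, approximable g &
    (L2norm delta (fun z => f z - g z)%R < e%:E)%E) -> approximable f.
Proof.
move=> mf H; split=> // e e0.
have e20 : 0 < e / 2 by rewrite divr_gt0.
have [g [mg ag] fg] := H _ e20.
have [phi [tphi gphi]] := ag _ e20; exists phi; split=> //.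
have mphi := measurable_test tphi.
rewrite (_ : (fun z => f z - phi z) = (fun z => (f z - g z) + (g z - phi z))).
  apply: le_lt_trans (L2norm_triangle _ _) _; [exact: measurable_funB..|].
  by rewrite [e]splitr EFinD lteD.
by apply/funext => z; rewrite addrA subrK.
Qed.

Lemma approximable_ae f g : measurable_fun setT g -> approximable f ->
  L2eq delta f g -> approximable g.
Proof.
move=> mg [mf af] fg; split=> // e /af [phi [tphi fphi]]; exists phi; split=> //.
have mphi := measurable_test tphi.
rewrite -(@L2norm_ae _ _ (fun z => f z - phi z))//; [exact: measurable_funB..|].
by apply: ae_imp fg => z ->.
Qed.

Lemma approximable0 : approximable (cst 0).
Proof.
split=> // e e0; exists (cst 0); split.
  apply: (test_functionI delta_gt0 ltr01) => [|z]; last by rewrite eqxx.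
  by apply/smoothP => k; exact: Ck_cst.
apply: L2norm_ltP => //=; under eq_integral do rewrite subrr expr0n.
by rewrite integral0 lte_fin exprn_gt0.
Qed.

Lemma approximableD f g : approximable f -> approximable g ->
  approximable (fun z => f z + g z).
Proof.
move=> [mf af] [mg ag]; split=> [|e e0]; first exact: measurable_funD.
have e20 : 0 < e / 2 by rewrite divr_gt0.
have [phi [tphi fphi]] := af _ e20; have [psi [tpsi gpsi]] := ag _ e20.
have mphi := measurable_test tphi; have mpsi := measurable_test tpsi.
exists (phi \+ psi); split; first exact: test_functionD.
rewrite (_ : (fun z => _) = (fun z => (f z - phi z) + (g z - psi z))).
  apply: le_lt_trans (L2norm_triangle _ _) _; [exact: measurable_funB..|].
  by rewrite [e]splitr EFinD lteD.
by apply/funext => z /=; ring.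
Qed.

Lemma L2normZ (a : R) f : measurable_fun setT f ->
  (L2norm delta (fun z => a * f z)%R = `|a|%:E * L2norm delta f)%E.
Proof.
move=> mf; rewrite !L2normE; under eq_integral do rewrite exprMn EFinM.
rewrite ge0_integralZl_EFin ?sqr_ge0//.
- rewrite poweRM ?lee_fin ?sqr_ge0//.
    by rewrite poweR_EFin powR12_sqrt ?sqr_ge0// sqrtr_sqr.
  by apply: integral_ge0 => z _; rewrite lee_fin sqr_ge0.
- by move=> z _; rewrite lee_fin sqr_ge0.
- by apply/measurable_EFinP; exact: measurable_funX.
Qed.

Lemma approximableZ (a : R) f : approximable f -> approximable (fun z => a * f z).
Proof.
move=> [mf af]; split=> [|e e0]; first exact: measurable_funM.
have a0 : 0 < `|a| + 1 by rewrite ltr_wpDl.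
have [phi [tphi fphi]] := af _ (divr_gt0 e0 a0).
exists (a \*: phi); split.
  by apply: (test_functionMl (g := cst a)) => //; apply/smoothP => k; exact: Ck_cst.
rewrite (_ : (fun z => _) = (fun z => a * (f z - phi z))).
  have mphi := measurable_test tphi.
  rewrite L2normZ; last exact: measurable_funB.
  apply: (@le_lt_trans _ _ ((`|a| + 1)%:E * L2norm delta (fun z => f z - phi z)%R)%E).
    by rewrite lee_wpmul2r ?Lnorm_ge0// lee_fin lerDl.
  by rewrite -lte_pdivlMl// -EFinM mulrC.
by apply/funext => z /=; rewrite mulrBr.
Qed.

End approximation.

(** * Density of the test functions *)

Section density.
Context {R : realType} (delta : R) (delta_gt0 : 0 < delta).

Local Notation plane := (measurableTypeR R * measurableTypeR R)%type.
Local Notation lambda2 := (@lebesgue_measure R \x @lebesgue_measure R)%E.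
Local Notation mu := (annulus_measure delta).
Local Notation approximable := (approximable delta).
Implicit Types (f g h : plane -> R) (A B C : set plane).

Lemma measurable_sqradius : measurable_fun setT (sqradius : plane -> R).
Proof. by apply: continuous_measurable_fun2; exact: continuous_sqradius. Qed.

Lemma measurable_circle (s : R) :
  measurable ([set z | sqradius z = s] : set plane).
Proof.
rewrite (_ : mkset _ = setT `&` sqradius @^-1` [set s]); last by rewrite setTI.
exact: measurable_sqradius.
Qed.

(** Every vertical line meets a circle in at most two points. *)
Lemma circle_null (s : R) : lambda2 ([set z | sqradius z = s] : set plane) = 0%E.
Proof.
apply: integral0_eq => x _ /=; apply: countable_lebesgue_measure0.
pose y := Num.sqrt (s - x ^+ 2).
apply: (@sub_countable _ _ _ [set y; - y]); last first.
  by apply: finite_set_countable; exact: finite_set2.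
apply: subset_card_le => t; rewrite /xsection /= inE /sqradius /= => ts.
have yE : y = `|t| by rewrite /y -ts addrC addKr sqrtr_sqr.
have [t0|t0] := leP 0 t; [left|right]; rewrite yE.
  by rewrite ger0_norm.
by rewrite ltr0_norm// opprK.
Qed.

(** The windows converge to an indicator in the open annulus only; this is enough,
    as the two boundary circles are null sets. *)
Lemma ae_annulus_interior :
  \forall z \ae mu, delta ^+ 2 < sqradius z < 1.
Proof.
pose N : set plane := [set z | sqradius z = delta ^+ 2] `|`
  [set z | sqradius z = 1] `|` ~` annulus delta.
have mD := measurable_annulus delta.
have mC s := measurable_circle s.
have mN : measurable N.
  by apply: measurableU; [apply: measurableU|exact: measurableC].
exists N; split => //; last first.
  move=> z /= /negP nz; rewrite /N.
  have [/(annulusE delta_gt0)/andP[z1 z2]|] := pselect (annulus delta z); last by right.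
  left; move: nz; rewrite negb_and -!leNgt => /orP[h|h]; [left|right] => /=.
    by apply/eqP; rewrite eq_le z1 h.
  by apply/eqP; rewrite eq_le z2 h.
rewrite annulus_measureE; apply/eqP; rewrite eq_le measure_ge0 andbT.
apply: (@le_trans _ _ (lambda2 ([set z | sqradius z = delta ^+ 2] `|`
   [set z | sqradius z = 1]))).
  apply: le_measure; rewrite ?inE; [exact: measurableI|exact: measurableU|].
  by move=> z [[//|]].
apply: le_trans (measureU2 _ (mC _) (mC _)) _.
by rewrite /= !circle_null adde0.
Qed.

Lemma integrable_cst1 : mu.-integrable setT (fun z => (cst (1 : R) z ^+ 2)%:E).
Proof.
apply: (@measurable_bounded_integrable _ _ _ _ (fun z => cst (1 : R) z ^+ 2)) => //.
- exact: annulus_measure_finite.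
- exact: measurable_funX.
- by exists 1; split => // M M1 z _; rewrite /= expr1n normr1 ltW.
Qed.

Lemma approximable_quadrant (a c : R) :
  approximable (\1_[set z : plane | a < z.1 /\ c < z.2]).
Proof.
set Q := [set z : plane | _].
have mQ : measurable Q.
  rewrite (_ : Q = `]a, +oo[%classic `*` `]c, +oo[%classic).
    by apply: measurableX; exact: measurable_itv.
  by apply/seteqP; split => z /=; rewrite !in_itv /= !andbT.
have mf : measurable_fun setT (\1_Q : plane -> R) by exact: measurable_indic.
split => // e e0.
have tw n := test_function_window delta_gt0 n a c.
have [n Hn] : exists n,
    (L2norm delta (fun z => \1_Q z - window delta n a c z)%R < e%:E)%E.
  apply: (@L2norm_dominated _ _ _ (cst 1)) => //.
  - by move=> n; apply: measurable_funB => //; exact: measurable_test (tw n).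
  - apply: ae_imp ae_annulus_interior => z zi.
    rewrite -(subrr (\1_Q z : R)); apply: cvgB; first exact: cvg_cst.
    rewrite indicE (_ : z \in Q = [&& a < z.1, c < z.2,
      delta ^+ 2 < sqradius z & sqradius z < 1]); first exact: window_cvg.
    by rewrite zi andbT; apply/idP/andP; rewrite inE.
  - exact: integrable_cst1.
  - move=> n z; rewrite normr1 ler_norml indicE.
    have := window_ge0 delta n a c z; have := window_le1 delta n a c z.
    by case: (z \in Q) => /= ? ?; apply/andP; split; lra.
by exists (window delta n a c).
Qed.

(** Dynkin's lemma: approximability of indicators passes from a generating
    pi-system to the whole sigma-algebra. *)
Lemma approximable_preimage d (T : measurableType d) (p : plane -> T) C
    (G : set (set T)) :
  measurable_fun setT p -> measurable C -> approximable (\1_C) ->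
  setI_closed G -> @measurable _ T = <<s G>> ->
  (forall A : set T, G A -> approximable (\1_(p @^-1` A `&` C))) ->
  forall A : set T, measurable A -> approximable (\1_(p @^-1` A `&` C)).
Proof.
move=> mp mC aC GI GE GA A; rewrite GE.
have mpA (B : set T) : measurable B -> measurable (p @^-1` B `&` C).
  by move=> mB; apply: measurableI => //; rewrite -[X in measurable X]setTI; exact: mp.
move: A; apply: (dynkin_induction
  (P := fun A : set T => approximable (\1_(p @^-1` A `&` C)))) => //.
- by rewrite preimage_setT setTI.
- move=> B mB aB.
  rewrite (_ : \1_ _ = (fun z => \1_C z + (- 1) * \1_(p @^-1` B `&` C) z)).
    by apply: approximableD => //; exact: approximableZ.
  apply/funext => z; rewrite !indicE preimage_setC !in_setI in_setC mulN1r.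
  by case: (z \in C); case: (z \in _); rewrite /= ?subr0 ?subrr.
- move=> F mF tF aF.
  (* The finite unions are handled by additivity, the limit by dominated convergence. *)
  pose U n := \bigcup_(i < n) F i.
  have mU n : measurable (U n) by apply: bigcup_measurable => i _; exact: mF.
  have mUF : measurable (\bigcup_k F k) by apply: bigcup_measurable => k _; exact: mF.
  have UF n : U n `<=` \bigcup_k F k by move=> t [i _ Fit]; exists i.
  have aU n : approximable (\1_(p @^-1` (U n) `&` C)).
    elim: n => [|n IH].
      rewrite (_ : U 0%N = set0); last first.
        by rewrite /U; apply: bigcup0 => i /=; rewrite ltn0.
      by rewrite preimage_set0 set0I indic0; exact: approximable0.
    rewrite (_ : \1_ _ = (fun z => \1_(p @^-1` (U n) `&` C) z +
        \1_(p @^-1` (F n) `&` C) z)); first exact: approximableD.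
    apply/funext => z; rewrite !indicE !in_setI.
    have -> : (z \in p @^-1` (U n.+1)) = (z \in p @^-1` (U n)) || (z \in p @^-1` (F n)).
      apply/idP/orP; rewrite !inE /preimage /=.
        move=> [i /= + Fi]; rewrite ltnS leq_eqVlt => /predU1P[<-|iltn]; first by right.
        by left; exists i.
      move=> [[i /= iltn Fi]|Fn]; last by exists n => /=.
      by exists i => //=; exact: ltnW.
    have [Uz|] := boolP (z \in p @^-1` (U n)) => /=; last by rewrite add0r.
    rewrite (_ : z \in p @^-1` (F n) = false) /= ?addr0//.
    apply/negbTE/negP; move: Uz; rewrite !inE /preimage /= => -[i /= iltn Fi] Fn.
    have /trivIsetP/(_ i n I I) := tF; rewrite neq_ltn iltn => /(_ isT) E.
    by have : (F i `&` F n) (p z) by []; rewrite E.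
  apply: approximable_limit => [|e e0].
    by apply: measurable_indic; exact: mpA.
  have [n Hn] : exists n, (L2norm delta (fun z =>
      \1_(p @^-1` (\bigcup_k F k) `&` C) z - \1_(p @^-1` (U n) `&` C) z)%R < e%:E)%E.
    apply: (@L2norm_dominated _ _ _ (cst 1)) => //.
    + move=> n; apply: measurable_funB; apply: measurable_indic; exact: mpA.
    + apply: aeW => z; have [[k _ Fk]|nF] := pselect ((\bigcup_k F k) (p z)).
        apply: cvg_near_cst; near=> n; rewrite !indicE !in_setI.
        have Un : U n (p z) by exists k => //=; near: n; exists k.+1.
        rewrite (mem_set (UF n _ Un : (p @^-1` _) z)).
        by rewrite (mem_set (Un : (p @^-1` _) z)) subrr.
      apply: cvg_near_cst; apply: nearW => n; rewrite !indicE !in_setI.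
      have nU : ~ U n (p z) by move=> /UF.
      by rewrite (memNset (nF : ~ (p @^-1` _) z)) (memNset (nU : ~ (p @^-1` _) z)) subrr.
    + exact: integrable_cst1.
    + move=> n z; rewrite normr1 !indicE !in_setI.
      have : (z \in p @^-1` (U n)) ==> (z \in p @^-1` (\bigcup_k F k)).
        by apply/implyP; rewrite !inE; exact: UF.
      case: (z \in C); case: (z \in p @^-1` (U n)); case: (z \in _) => //= _;
        by rewrite ?subrr ?subr0 ?normr0 ?normr1.
  by exists (\1_(p @^-1` (U n) `&` C)).
Unshelve. all: by end_near. Qed.

Lemma setI_closed_ray : setI_closed (@RGenOInfty.G R).
Proof.
move=> _ _ [a ->] [b ->]; exists (Num.max a b); apply/seteqP.
split => x /=; rewrite !in_itv /= !andbT gt_max; first by case=> -> ->.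
by case/andP.
Qed.

(** Any bound below [- 1] would do: up to null sets the whole plane is a quadrant. *)
Lemma ae_gtN2 : \forall z \ae mu, - 2 < z.1 /\ - 2 < z.2.
Proof.
apply: ae_imp ae_annulus_interior => z /andP[z1 z2].
have /(annulus_square delta_gt0)/andP[/andP[? _] /andP[? _]] : annulus delta z.
  by apply/(annulusE delta_gt0); rewrite !ltW.
by split; lra.
Qed.

(** The strips and rectangles below are built from quadrants one coordinate at a
    time, since the rays generate the Borel sets of the line. *)
Lemma approximable_strip (A : set (measurableTypeR R)) (c : R) : measurable A ->
  approximable (\1_(fst @^-1` A `&` [set z : plane | c < z.2])).
Proof.
have mC : measurable [set z : plane | c < z.2].
  rewrite (_ : mkset _ = setT `*` `]c, +oo[%classic).
    by apply: measurableX => //; exact: measurable_itv.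
  by apply/seteqP; split => z /=; rewrite in_itv /= andbT // => -[].
move: A; apply: (approximable_preimage (G := @RGenOInfty.G R)) => //.
- apply: approximable_ae (approximable_quadrant (- 2) c) _.
    exact: measurable_indic.
  apply: ae_imp ae_gtN2 => z [z1 _]; rewrite !indicE; congr (nat_of_bool _)%:R.
  by apply/idP/idP; rewrite !inE => //= -[].
- exact: setI_closed_ray.
- exact: RGenOInfty.measurableE.
- move=> _ [a ->]; rewrite (_ : _ `&` _ = [set z : plane | a < z.1 /\ c < z.2]).
    exact: approximable_quadrant.
  by apply/seteqP; split => z /=; rewrite in_itv /= andbT.
Qed.

Lemma approximable_rectangle (A B : set (measurableTypeR R)) :
  measurable A -> measurable B -> approximable (\1_(A `*` B)).
Proof.
move=> mA; have mfA : measurable (fst @^-1` A : set plane).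
  by rewrite -[X in measurable X]setTI; exact: measurable_fst.
rewrite (_ : A `*` B = snd @^-1` B `&` fst @^-1` A); last first.
  by apply/seteqP; split => z [].
move: B; apply: (approximable_preimage (G := @RGenOInfty.G R)) => //.
- apply: approximable_ae (approximable_strip (- 2) mA) _.
    exact: measurable_indic.
  apply: ae_imp ae_gtN2 => z [_ z2]; rewrite !indicE; congr (nat_of_bool _)%:R.
  by apply/idP/idP; rewrite !inE => //= -[].
- exact: setI_closed_ray.
- exact: RGenOInfty.measurableE.
- move=> _ [c ->]; rewrite setIC (_ : snd @^-1` _ = [set z : plane | c < z.2]).
    exact: approximable_strip.
  by apply/seteqP; split => z /=; rewrite in_itv /= andbT.
Qed.

Lemma approximable_indic A : measurable A -> approximable (\1_A).
Proof.
move=> mA; rewrite -[A]setIT -[A]/(id @^-1` A).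
move: A mA; apply: (approximable_preimage (p := id)
  (G := [set A `*` B | A in measurable & B in measurable])) => //.
- by rewrite -setXTT; exact: approximable_rectangle.
- move=> _ _ [A mA [B mB <-]] [A' mA' [B' mB' <-]].
  exists (A `&` A'); first exact: measurableI.
  by exists (B `&` B'); [exact: measurableI|rewrite setXI].
- exact: measurable_prod_measurableType.
- by move=> _ [A mA [B mB <-]]; rewrite setIT; exact: approximable_rectangle.
Qed.

Lemma approximable_sum (I : Type) (r : seq I) (F : I -> plane -> R) :
  (forall i, approximable (F i)) -> approximable (fun z => \sum_(i <- r) F i z).
Proof.
move=> aF; elim: r => [|i r IH].
  rewrite (_ : (fun z => _) = cst 0); first exact: approximable0.
  by apply/funext => z; rewrite big_nil.
rewrite (_ : (fun z => _) = (fun z => F i z + \sum_(j <- r) F j z)).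
  exact: approximableD.
by apply/funext => z; rewrite big_cons.
Qed.

Import HBNNSimple.

Lemma approximable_nnsfun (s : {nnsfun plane >-> R}) : approximable s.
Proof.
rewrite (_ : (s : plane -> R) = (fun z => \sum_(y <- finmap.enum_fset (fset_set (range s)))
    y * \1_(s @^-1` [set y]) z)).
  apply: approximable_sum => y; apply: approximableZ => //.
  exact: approximable_indic.
by apply/funext => z; rewrite fimfunE fsbig_finite.
Qed.

(** The simple functions that increase to [f] stay below it, so [f] dominates
    the error. *)
Lemma approximable_ge0 f : (forall z, 0 <= f z) -> measurable_fun setT f ->
  mu.-integrable setT (fun z => (f z ^+ 2)%:E) -> approximable f.
Proof.
move=> f0 mf if2.
have mfE : measurable_fun setT (EFin \o f) by exact/measurable_EFinP.
pose s := nnsfun_approx measurableT mfE.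
have f0E z : setT z -> (0 <= (EFin \o f) z)%E by move=> _; rewrite lee_fin.
have sf z : s n z @[n --> \oo] --> f z.
  by have := cvg_nnsfun_approx measurableT mfE f0E (I : setT z) => /fine_cvgP[].
have s_le n z : s n z <= f z.
  have nds : nondecreasing_seq (s ^~ z).
    by move=> i j ij; have /lefP := nd_nnsfun_approx measurableT mfE ij; exact.
  have := nondecreasing_cvgn_le nds (cvgP _ (sf z)) n.
  by rewrite (cvg_lim _ (sf z)).
apply: approximable_limit => // e e0.
have [n Hn] : exists n, (L2norm delta (fun z => f z - s n z)%R < e%:E)%E.
  apply: (@L2norm_dominated _ _ _ f) => //.
  - by move=> n; apply: measurable_funB.
  - by apply: aeW => z; rewrite -(subrr (f z)); apply: cvgB; [exact: cvg_cst|exact: sf].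
  - by move=> n z; rewrite !ger0_norm ?subr_ge0// gerBl.
by exists (s n) => //; exact: approximable_nnsfun.
Qed.

Lemma L2_approximable (u : L2 delta) : approximable u.
Proof.
have mu_ : measurable_fun setT (u : plane -> R) by [].
have iu2 : mu.-integrable setT (fun z => (u z ^+ 2)%:E).
  exact: Lfun2_integrable_sqr (LfunP u).
have apos f : measurable_fun setT f -> (forall z, `|f z| = `|u z|) ->
    approximable (fun z => Num.max (f z) 0).
  move=> mf fu; have mf0 : measurable_fun setT (fun z => Num.max (f z) 0).
    exact: measurable_maxr.
  apply: approximable_ge0 => //; first by move=> z; rewrite le_max lexx orbT.
  apply: le_integrable iu2 => //.
    by apply/measurable_EFinP; exact: measurable_funX.
  move=> z _ /=; rewrite lee_fin !ger0_norm ?sqr_ge0//.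
  rewrite -[leRHS]real_normK ?num_real// lerXn2r ?nnegrE ?le_max ?lexx ?orbT//.
  by rewrite ge_max -fu ler_norm normr_ge0.
apply: approximable_ae mu_ (approximableD (apos u mu_ _)
  (approximableZ (- 1) (apos (fun z => - u z) _ _))) _ => //.
- exact: measurable_funN.
- by move=> z; rewrite normrN.
- by apply: aeW => z /=; case: (ltP (u z) 0) => ?; [rewrite max_l|rewrite max_r]; lra.
Qed.

End density.

(** * The inviscid limit *)

Section vanishing_viscosity.
Context {R : realType} (delta : R) (delta_gt0 : 0 < delta).

Local Notation plane := (measurableTypeR R * measurableTypeR R)%type.
Local Notation mu := (annulus_measure delta).

Lemma le_L2norm (f g : plane -> R) : measurable_fun setT f -> measurable_fun setT g ->
  (forall z, `|f z| <= `|g z|) -> (L2norm delta f <= L2norm delta g)%E.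
Proof.
move=> mf mg fg; rewrite !L2normE; apply: gt0_ler_poweR.
- by rewrite invr_ge0.
- by rewrite in_itv /= leey andbT; apply: integral_ge0 => z _; rewrite lee_fin sqr_ge0.
- by rewrite in_itv /= leey andbT; apply: integral_ge0 => z _; rewrite lee_fin sqr_ge0.
apply: ge0_le_integral => //.
- by move=> z _; rewrite lee_fin sqr_ge0.
- by apply/measurable_EFinP; exact: measurable_funX.
- by apply/measurable_EFinP; exact: measurable_funX.
- move=> z _; rewrite lee_fin -[leLHS]real_normK ?num_real//.
  by rewrite -[leRHS]real_normK ?num_real// lerXn2r ?nnegrE.
Qed.

Lemma L2norm_norm (f : plane -> R) : L2norm delta (fun z => `|f z|) = L2norm delta f.
Proof.
by rewrite !L2normE; under eq_integral do rewrite real_normK ?num_real//.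
Qed.

Lemma L2vec_norm_le (w : L2 delta * L2 delta) :
  (L2vec_norm w <= (norm2 w.1 + norm2 w.2)%:E)%E.
Proof.
have m1 : measurable_fun setT (w.1 : plane -> R) by [].
have m2 : measurable_fun setT (w.2 : plane -> R) by [].
have mn1 : measurable_fun setT (fun z : plane => `|w.1 z|) by exact: measurableT_comp.
have mn2 : measurable_fun setT (fun z : plane => `|w.2 z|) by exact: measurableT_comp.
have -> : (norm2 w.1 + norm2 w.2)%:E = (L2norm delta w.1 + L2norm delta w.2)%E.
  by rewrite -!norm2E.
rewrite /L2vec_norm -(L2norm_norm w.1) -(L2norm_norm w.2).
apply: (le_trans _ (L2norm_triangle delta mn1 mn2)); apply: le_L2norm.
- apply: measurableT_comp; first exact: continuous_measurable_fun (@sqrt_continuous R).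
  by apply: measurable_funD; exact: measurable_funX.
- exact: measurable_funD.
move=> z; rewrite ger0_norm ?sqrtr_ge0// ger0_norm ?addr_ge0//.
rewrite -[leRHS]ger0_norm ?addr_ge0// -sqrtr_sqr ler_wsqrtr//.
rewrite sqrrD !real_normK ?num_real// lerD2r lerDl.
by rewrite mulrn_wge0// mulr_ge0.
Qed.

Lemma Linf_le (T e : R) (w : R -> L2 delta * L2 delta) : 0 <= e ->
  (forall t, 0 < t < T -> (L2vec_norm (w t) <= e%:E)%E) ->
  (0 <= LinfL2_norm T w <= e%:E)%E.
Proof.
move=> e0 we; rewrite Lnorm_ge0 /= /LinfL2_norm unlock.
case: ifPn => [_|]; last by rewrite lee_fin.
(* The bound may fail outside the time interval, which the measure does not charge. *)
apply/ess_supP.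
exists (~` `]0, T[%classic); split.
- by apply: measurableC; exact: measurable_itv.
- by rewrite /= /mrestr setICl measure0.
- move=> t /= nt; apply: contra_not nt; rewrite in_itv /= => t0T.
  by rewrite gee0_abs ?Lnorm_ge0// we.
Qed.

Context (expA : R * R -> R -> L2 delta -> L2 delta).
Context (hexpA : forall nu : R * R, 0 < nu.1 -> 0 < nu.2 ->
  generated_by (A_graph nu) (expA nu)).

(** For a test function [f] close to [u], the bound of [displacement_le] is twice the
    distance from [u] to [f] plus [t (nu.1 |g1| + nu.2 |g2|)], with [g1] and [g2]
    independent of [nu]. *)
Lemma displacement_vanishes (T : R) (u : L2 delta) (e : R) : 0 < T -> 0 < e ->
  exists2 d : R, 0 < d & forall nu : R * R, 0 < nu.1 < d -> 0 < nu.2 < d ->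
  forall t, 0 < t < T -> norm2 (expA nu t u - u) <= e.
Proof.
move=> T0 e0.
have [phi [tphi uphi]] := (L2_approximable delta_gt0 u).2 _ (divr_gt0 e0 (ltr0n _ 4)).
have [v vphi] := L2_test delta_gt0 tphi.
have [g1 [g2 Ag]] := A_graph_test delta_gt0 tphi vphi.
have uv : norm2 (u - v) <= e / 4.
  rewrite -lee_fin norm2E; apply: ltW; move: uphi; rewrite -vphi.
  by [].
have G0 : 0 <= norm2 g1 + norm2 g2 by rewrite addr_ge0 ?norm2_ge0.
pose d := e / 2 / (T * (norm2 g1 + norm2 g2) + 1).
have D0 : 0 < T * (norm2 g1 + norm2 g2) + 1.
  by rewrite ltr_wpDl// mulr_ge0// ltW.
have d0 : 0 < d by rewrite !divr_gt0.
have dE : d * (T * (norm2 g1 + norm2 g2) + 1) = e / 2 by rewrite divfK// gt_eqF.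
exists d => // nu /andP[n1 n1d] /andP[n2 n2d] t /andP[t0 tT].
have [CS gen] := hexpA n1 n2.
have := displacement_le CS u ((gen _ _).2 (Ag nu)) (ltW t0).
have gd : norm2 (nu.1 *: g1 + nu.2 *: g2) <= d * (norm2 g1 + norm2 g2).
  apply: le_trans (norm2D _ _) _; rewrite !norm2Z !gtr0_norm// mulrDr.
  by apply: lerD; rewrite ler_wpM2r ?norm2_ge0// ltW.
have tgd : t * norm2 (nu.1 *: g1 + nu.2 *: g2) <= e / 2.
  apply: (@le_trans _ _ (T * (d * (norm2 g1 + norm2 g2)))).
    by apply: ler_pM => //; rewrite ?norm2_ge0// ltW.
  by rewrite mulrCA -dE ler_wpM2l ?(ltW d0)// lerDl.
lra.
Qed.

End vanishing_viscosity.

Theorem theorem4p1 (R : realType) (delta : R)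
    (hdelta : 0 < delta < 1)
    (a : R -> R) (u0 : L2 delta * L2 delta)
    (hu0 : circularly_symmetric a u0)
    (expA : R * R -> R -> L2 delta -> L2 delta)
    (hexpA : forall nu : R * R, 0 < nu.1 -> 0 < nu.2 ->
      generated_by (A_graph nu) (expA nu))
    (T : R) (hT : 0 < T) :
  LinfL2_norm T (fun t => navier_stokes_flow (expA nu) u0 t - euler_flow u0 t)
    @[nu --> filter_prod 0^'+ 0^'+] --> 0%E.
Proof.
have /andP[delta_gt0 _] := hdelta.
have small (e : R) : 0 < e -> \forall nu \near filter_prod 0^'+ 0^'+,
    (0 <= LinfL2_norm T (fun t => (navier_stokes_flow (expA nu) u0 t - euler_flow u0 t)%R)
       <= e%:E)%E.
  move=> e0; have e20 : 0 < e / 2 by rewrite divr_gt0.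
  have [d1 d10 H1] := displacement_vanishes delta_gt0 hexpA u0.1 hT e20.
  have [d2 d20 H2] := displacement_vanishes delta_gt0 hexpA u0.2 hT e20.
  have d0 : 0 < Num.min d1 d2 by rewrite lt_min d10.
  exists ([set x : R | 0 < x < Num.min d1 d2], [set x : R | 0 < x < Num.min d1 d2]).
    by split; near=> x; (apply/andP; split => //); near: x; exact: nbhs_right_lt.
  move=> [nu1 nu2] /= [/andP[n1 n1d] /andP[n2 n2d]].
  move: n1d n2d; rewrite !lt_min => /andP[? ?] /andP[? ?].
  apply: Linf_le => [|t t0T]; first exact: ltW.
  apply: le_trans (L2vec_norm_le _) _; rewrite lee_fin [leRHS]splitr.
  by apply: lerD; [apply: H1|apply: H2] => //; apply/andP; split.
apply/fine_cvgP; split.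
  apply: filterS (small 1 ltr01) => nu /andP[h0 h1].
  by rewrite ge0_fin_numE// (le_lt_trans h1)// ltry.
apply/cvgrPdist_le => e e0; apply: filterS (small _ e0) => nu /andP[h0 h1].
rewrite sub0r normrN ger0_norm ?fine_ge0//= -lee_fin fineK//.
by rewrite ge0_fin_numE// (le_lt_trans h1)// ltry.
Unshelve. all: by end_near. Qed.
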